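(* Let $\Omega\subset\mathbb{R}^n$ be compact and convex, and consider the system $\dot x(t)=f(t,x(t))$, where $f$ is $C^1$ with respect to $x$ and $\Omega$ is invariant: for any $x_0\in\Omega$ and any $t_0\ge 0$ a unique solution with $x(t_0)=x_0$ exists and stays in $\Omega$ for all $t\ge t_0$. Let $J(t,x):=\frac{\partial}{\partial x}f(t,x)$ be the Jacobian of the dynamics, and let $T>0$. Assume: (i) for any $t\ge 0$ and along any line $\gamma:[0,1]\to\Omega$ the matrix $$A(t):=\int_0^1 J(t,\gamma(r))\,dr$$ is well-defined, locally (essentially) bounded, and measurable, and $\dot\Phi(t)=A(t)\Phi(t)$ is a totally positive differential system (TPDS); (ii) $f(t,z)=f(t+T,z)$ for all $z\in\Omega$ and $t\ge 0$. Then every solution of $\dot x(t)=f(t,x(t))$ (with initial condition $x(0)\in\Omega$) converges to a $T$-periodic trajectory.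
   Context: A line $\gamma:[0,1]\to\Omega$ is a map of the form $\gamma(r)=rp+(1-r)q$ with $p,q\in\Omega$. A square real matrix is totally positive (TP) if the determinant of every square submatrix (every minor) is positive. For a measurable, locally essentially bounded $A$, the system $\dot\Phi=A\Phi$ is a TPDS on an interval $(\tau_1,\tau_2)$ if for all $\tau_1<t_0<t<\tau_2$ the matrix $\Phi(t,t_0)$ is TP, where $\Phi(\cdot,t_0)$ is the locally absolutely continuous solution of $\frac{d}{dt}\Phi(t,t_0)=A(t)\Phi(t,t_0)$ (for almost every $t$), $\Phi(t_0,t_0)=I$. Here the time interval is $(0,\infty)$. A solution $\eta(t)$ of $\dot x=f(t,x)$ is called a $T$-periodic trajectory if $\eta(t+T)=\eta(t)$ for all $t$. A solution $x(t)$ converges to it if $|x(t)-\eta(t)|\to 0$ as $t\to\infty$.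
   Formalization: In (i) the line may move: its endpoints p(t), q(t) in Ω may be any continuous functions of t, and A(t) is taken along the line at time t. With only lines fixed in time, the claim is false (there is a counterexample for n=3). *)

(* Defs.v *)
From HB Require Import structures.
From mathcomp Require Export all_boot all_order all_algebra.
From mathcomp Require Export all_classical all_reals all_analysis.
Export Order.TTheory GRing.Theory Num.Theory.
Export numFieldNormedType.Exports.

Set Implicit Arguments.
Unset Strict Implicit.
Unset Printing Implicit Defensive.

#[export] Set Implicit Arguments.
#[export] Unset Strict Implicit.
#[export] Unset Printing Implicit Defensive.

#[global] Open Scope classical_set_scope.
#[global] Open Scope ring_scope.

(* The state space R^n is 'rV[R]_n; matrices act on states as on columns, so
   the linear system is Phi' = A *m Phi with A : 'M[R]_n. *)

Definition abs_continuous (R : realType) (V : normedModType R)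
    (a b : R) (F : R -> V) : Prop :=
  forall e : R, 0 < e -> exists2 d : R, 0 < d &
    forall (m : nat) (u v : 'I_m -> R),
      (forall i, a <= u i /\ u i <= v i /\ v i <= b) ->
      (forall i j, i != j -> v i <= u j \/ v j <= u i) ->
      \sum_(i < m) (v i - u i) < d ->
      \sum_(i < m) `|F (v i) - F (u i)| < e.

Definition locally_abs_continuous (R : realType) (V : normedModType R)
    (I : set R) (F : R -> V) : Prop :=
  forall a b : R, `[a, b] `<=` I -> abs_continuous a b F.

Definition locally_ess_bounded (R : realType) (V : normedModType R)
    (I : set R) (F : R -> V) : Prop :=
  forall a b : R, `[a, b] `<=` I -> exists M : R,
    \forall t \ae (@lebesgue_measure R), t \in `[a, b] -> `|F t| <= M.

Definition measurable_mx (R : realType) (n : nat) (I : set R)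
    (A : R -> 'M[R]_n) : Prop :=
  forall i j, measurable_fun I (fun t => A t i j).

(* A minor is given by its (increasing) row and column selections. *)
Definition totally_positive (R : realType) (n : nat) (M : 'M[R]_n) : Prop :=
  forall (k : nat) (f g : 'I_k -> 'I_n),
    {homo f : i j / (i < j)%N} -> {homo g : i j / (i < j)%N} ->
    0 < \det (mxsub f g M).

(* Phi t s is the state-transition matrix from time s to time t. *)
Definition is_transition (R : realType) (n : nat) (I : set R)
    (A : R -> 'M[R]_n) (Phi : R -> R -> 'M[R]_n) : Prop :=
  forall s, I s ->
    [/\ Phi s s = 1%:M,
        locally_abs_continuous I (fun t => Phi t s) &
        \forall t \ae (@lebesgue_measure R), I t ->
          is_derive (t : R^o) 1 (fun r : R^o => Phi r s) (A t *m Phi t s)].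

Definition TPDS (R : realType) (n : nat) (I : set R)
    (A : R -> 'M[R]_n) : Prop :=
  exists2 Phi : R -> R -> 'M[R]_n, is_transition I A Phi &
    forall s t, I s -> I t -> s < t -> totally_positive (Phi t s).

(* Caratheodory solutions on [t0, +oo[. The derivative is two-sided, which
   excludes only the single time t0. *)
Definition is_solution (R : realType) (n : nat)
    (f : R -> 'rV[R]_n -> 'rV[R]_n) (t0 : R) (x : R -> 'rV[R]_n) : Prop :=
  locally_abs_continuous `[t0, +oo[ x /\
  \forall t \ae (@lebesgue_measure R), t0 <= t ->
    is_derive (t : R^o) 1 (x : R^o -> 'rV[R]_n) (f t (x t)).

(* 'J g x acts on row vectors from the right; the transpose has the usual
   entries (i, j) |-> d g_i / d x_j. *)
Definition Jac (R : realType) (n : nat) (g : 'rV[R]_n -> 'rV[R]_n)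
    (x : 'rV[R]_n) : 'M[R]_n :=
  ('J g x)^T.

Definition C1_on (R : realType) (n : nat) (Omega : set 'rV[R]_n)
    (g : 'rV[R]_n -> 'rV[R]_n) : Prop :=
  (forall x, Omega x -> differentiable g x) /\
  {within Omega, continuous (Jac g)}.

Definition invariant_domain (R : realType) (n : nat)
    (f : R -> 'rV[R]_n -> 'rV[R]_n) (Omega : set 'rV[R]_n) : Prop :=
  forall (t0 : R) (x0 : 'rV[R]_n), 0 <= t0 -> Omega x0 ->
    exists x : R -> 'rV[R]_n,
      [/\ is_solution f t0 x, x t0 = x0,
          forall t, t0 <= t -> Omega (x t) &
          forall y, is_solution f t0 y -> y t0 = x0 ->
            forall t, t0 <= t -> y t = x t].

Definition line (R : realType) (n : nat) (p q : 'rV[R]_n) (r : R) : 'rV[R]_n :=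
  r *: p + (1 - r) *: q.

(* Endpoints at time t of a line in Omega. The line may move continuously with
   t: constant p and q give a fixed line, and for two solutions p and q the
   difference p - q satisfies z' = mean_jacobian f p q t *m z. *)
Definition line_endpoints (R : realType) (n : nat) (Omega : set 'rV[R]_n)
    (p q : R -> 'rV[R]_n) : Prop :=
  [/\ {within `[0, +oo[, continuous p}, {within `[0, +oo[, continuous q} &
      forall t, 0 <= t -> Omega (p t) /\ Omega (q t)].

Definition mean_jacobian (R : realType) (n : nat)
    (f : R -> 'rV[R]_n -> 'rV[R]_n) (p q : R -> 'rV[R]_n) (t : R) : 'M[R]_n :=
  \matrix_(i, j)
    \int[@lebesgue_measure R]_(r in `[0, 1]) Jac (f t) (line (p t) (q t) r) i j.

Definition mean_jacobian_defined (R : realType) (n : nat)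
    (f : R -> 'rV[R]_n -> 'rV[R]_n) (p q : R -> 'rV[R]_n) (t : R) : Prop :=
  forall i j, (@lebesgue_measure R).-integrable `[0, 1]
    (fun r => (Jac (f t) (line (p t) (q t) r) i j)%:E).

(* Main.v *)
Require Import Defs.
From mathcomp Require Import measurable_realfun.
From mathcomp Require Import zify ring lra.

(* For two solutions u and v the difference z = u - v solves z' = A z, where A is
   the mean Jacobian along the segments [v, u]; hence z t = Phi t s *m z s with
   Phi t s totally positive.  A totally positive matrix diminishes sign
   variations, and a vector with vanishing first entry can be perturbed to gain
   one, so z_1 has no zero after the time at which the number of sign variations
   of z reaches its minimum, unless z = 0.  Applied to x (t + T) and x t, this
   makes x_1 eventually monotone along the orbit x (k T), so all limit points of
   the orbit share their first coordinate; applied to limit solutions it shows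
   that every limit point is T-periodic and that there is only one.  Passing to
   limit solutions requires a Lipschitz bound on the flow, i.e. an essential
   bound on the Jacobian uniform over Omega: otherwise a continuous path in Omega
   could be threaded through points of large Jacobian. *)

(** * Total positivity and sign variations *)

(** Sign variations are not counted but exhibited, in two versions: with zeros discarded, and with
    zeros given the most favourable signs. Total positivity bounds the second count at a later time
    by the first count at an earlier time, while a vanishing first entry makes the second exceed the
    first at the same time; the contradiction lives in this gap. Transition matrices are available
    between positive times only, so time 0 is reached by continuity.

    The other difficulty is uniformity: each mean Jacobian has its own bound, which may depend on
    the pair of paths, while limits of solutions call for one constant. Convexity of [Omega]
    supplies the missing paths: a path can leave a fixed centre towards a chosen point and come back
    within [Omega], and infinitely many such excursions stay continuous if they shrink. Solutions
    are merely absolutely continuous, so the growth estimates rest on a covering argument and not on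
    pointwise derivatives everywhere. *)

Lemma det_mulmx_distr (R : comPzRingType) (m n : nat)
    (A : 'M[R]_(m, n)) (W : 'M[R]_(n, m)) :
  \det (A *m W) = \sum_(f : {ffun 'I_m -> 'I_n})
     (\prod_i W (f i) i) * \det (colsub f A).
Proof.
rewrite -[LHS]det_tr {1}/determinant.
under eq_bigr => s _.
  under eq_bigr => i _ do rewrite !mxE.
  rewrite bigA_distr_bigA big_distrr /=.
  over.
rewrite exchange_big /=; apply: eq_bigr => f _.
rewrite -(det_tr (colsub f A)) /determinant big_distrr /=; apply: eq_bigr => s _.
rewrite big_split /= mulrA mulrC; congr (_ * (_ * _)).
by apply: eq_bigr => i _; rewrite !mxE.
Qed.

(** Greedy grouping from left to right: a new entry joins the last block if it is zero or has the
    sign of that block, and opens a block otherwise. Block [c] has sign [(-1) ^+ (e + c)], so [m] is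
    the number of sign changes of [z]. *)
Lemma sign_blocks (R : realFieldType) (z : nat -> R) (n : nat) :
    (exists2 j, (j < n)%N & z j != 0) ->
  exists m (b : nat -> nat) (e : nat),
   [/\ forall i j, (i <= j)%N -> (j < n)%N -> (b i <= b j)%N,
       forall j, (j < n)%N -> (b j < m.+1)%N,
       forall j, (j < n)%N -> 0 <= (-1) ^+ (e + b j) * z j &
       forall c, (c < m.+1)%N -> exists j, [/\ (j < n)%N, b j = c & z j != 0]].
Proof.
elim: n => [[j]//|n IHn] [j0 j0n zj0].
case: (pselect (exists2 j, (j < n)%N & z j != 0)) => [/IHn|noj].
- move=> [m [b [e [bmono bm bz bex]]]].
  have [mz|mz] := lerP 0 ((-1) ^+ (e + m) * z n).
  + exists m, (fun j => if (j < n)%N then b j else m), e; split.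
    * move=> i j ij jn; case: (ltnP j n) => [jn'|jn'].
        by rewrite (leq_ltn_trans ij jn') bmono.
      by case: (ltnP i n) => // i_n; rewrite -ltnS bm.
    * by move=> j _; case: (ltnP j n) => // /bm.
    * move=> j jn; case: (ltnP j n) => [/bz//|nj].
      by have -> : j = n by apply/eqP; rewrite eqn_leq nj -ltnS jn.
    * move=> c /bex[j [jn bj zj]]; exists j; rewrite jn; split => //.
      by rewrite ltnS ltnW.
  + exists m.+1, (fun j => if (j < n)%N then b j else m.+1), e; split.
    * move=> i j ij jn; case: (ltnP j n) => [jn'|jn'].
        by rewrite (leq_ltn_trans ij jn') bmono.
      by case: (ltnP i n) => // /bm/ltnW.
    * by move=> j _; case: (ltnP j n) => // /bm/leqW.
    * move=> j jn; case: (ltnP j n) => [/bz//|nj].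
      have -> : j = n by apply/eqP; rewrite eqn_leq nj -ltnS jn.
      by rewrite addnS exprS mulN1r mulNr oppr_ge0 ltW.
    * move=> c; rewrite ltnS leq_eqVlt => /orP[/eqP->|].
        exists n; rewrite ltnn; split => //.
        by apply: contraTneq mz => ->; rewrite mulr0 ltxx.
      move=> /bex[j [jn bj zj]]; exists j; rewrite jn; split => //.
      by rewrite ltnS ltnW.
- have j0E : j0 = n.
    apply/eqP; rewrite eqn_leq -ltnS j0n /= leqNgt; apply/negP => j0lt.
    by apply: noj; exists j0.
  have z0 j : (j < n)%N -> z j = 0.
    by move=> jn; apply/eqP/negP => /negP zj; apply: noj; exists j.
  (* Only zeros precede [z n]; they share its block, and the boolean [z n < 0] serves as the parity
     [e]. *)
  exists 0%N, (fun=> 0%N), (z n < 0); split => //.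
  + move=> j; rewrite ltnS leq_eqVlt => /orP[/eqP->|/z0->]; last by rewrite mulr0.
    by rewrite addn0; case: ltP => ? /=; rewrite ?expr0 ?expr1; lra.
  + by move=> c; rewrite ltnS leqn0 => /eqP->; exists n; split => //; rewrite -j0E.
Qed.

(** For positive [m] this is S^+(y) >= m - 1, zeros being allowed either sign;
    [strictly_alternating] is S^-(y) >= m - 1, zeros being discarded. The parity [e] leaves the
    first sign free. *)
Definition weakly_alternating (R : realFieldType) (n : nat) (m : nat)
    (y : 'cV[R]_n) : Prop :=
  exists (e : nat) (r : 'I_m -> 'I_n),
    {homo r : i j / (i < j)%N} /\ forall i : 'I_m, 0 <= (-1) ^+ (e + i) * y (r i) 0.

Definition strictly_alternating (R : realFieldType) (n : nat) (m : nat)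
    (y : 'cV[R]_n) : Prop :=
  exists (e : nat) (r : 'I_m -> 'I_n),
    {homo r : i j / (i < j)%N} /\ forall i : 'I_m, 0 < (-1) ^+ (e + i) * y (r i) 0.

Lemma weakly_alternating_le (R : realFieldType) (n m k : nat)
    (y : 'cV[R]_n) : (k <= m)%N ->
  weakly_alternating m y -> weakly_alternating k y.
Proof.
move=> km [e [r [rmono ry]]]; exists e, (fun i => r (widen_ord km i)); split.
  by move=> i j ij; apply: rmono.
by move=> i; exact: (ry (widen_ord km i)).
Qed.

(** A zero counts with either sign, so index 0 can be put in front of a strict selection, which
    cannot already contain it. *)
Lemma alternating_cons (R : realFieldType) (n m : nat) (y : 'cV[R]_n.+1) :
  y ord0 0 = 0 -> strictly_alternating m y -> weakly_alternating m.+1 y.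
Proof.
move=> y0 [e [r [rmono ry]]].
exists e.+1, (fun i => oapp r ord0 (unlift ord0 i)); split.
  move=> i j; case: (unliftP ord0 i) => [i'|] ->; case: (unliftP ord0 j) => [j'|] -> //=.
    by rewrite /= /bump /= !add1n ltnS; exact: rmono.
  move=> _; rewrite lt0n; apply/eqP => rj.
  have := ry j'; rewrite (_ : r j' = ord0) ?y0 ?mulr0 ?ltxx//.
  exact/val_inj.
move=> i; case: (unliftP ord0 i) => [i'|] -> /=; last by rewrite y0 mulr0.
rewrite /bump leq0n add1n addnS addSn !exprS mulrA mulrNN !mulr1 mul1r.
exact/ltW/ry.
Qed.

(* Column [c] collects, with absolute weights, the columns in block [c] of the
   partition [b] of the index set into sign-constant blocks of [z]. *)
Definition block_abs (R : realType) (n m : nat) (b : nat -> nat)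
    (z : 'I_n -> R) : 'M[R]_(n, m) :=
  \matrix_(j, c) if b j == c then `|z j| else 0.

(** Expand over all maps [f]. A term with some [f i] outside block [i] has a zero weight; any other
    [f] is increasing because the blocks are ordered, so its determinant is a minor of [A] and no
    regrouping as in Cauchy-Binet is required. Nonzero representatives of the blocks give one
    positive term. *)
Lemma det_block_abs_gt0 (R : realType) (n m : nat) (A : 'M[R]_n)
    (b : nat -> nat) (z : 'I_n -> R) (g : 'I_m -> 'I_n) :
  totally_positive A ->
  (forall i j : 'I_n, (i <= j)%N -> (b i <= b j)%N) ->
  (forall c : 'I_m, exists2 j : 'I_n, b j = c & z j != 0) ->
  {homo g : i j / (i < j)%N} -> 0 < \det (rowsub g A *m block_abs m b z).
Proof.
move=> A_TP b_mono b_onto gmono; rewrite det_mulmx_distr.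
have W0 (f : {ffun 'I_m -> 'I_n}) : 0 <= \prod_i block_abs m b z (f i) i.
  by apply: prodr_ge0 => i _; rewrite mxE; case: ifP.
have Wdet (f : {ffun 'I_m -> 'I_n}) : (forall i, b (f i) = i) ->
    0 < \det (colsub f (rowsub g A)).
  move=> bf; have -> : colsub f (rowsub g A) = mxsub g f A.
    by apply/matrixP => i j; rewrite !mxE.
  apply: A_TP => // i j ij; rewrite ltnNge; apply/negP => /b_mono.
  by rewrite !bf leqNgt ij.
have [f0 f0P] : {f : {ffun 'I_m -> 'I_n} |
    forall c, b (f c) = c /\ z (f c) != 0}.
  have /choice[h hP] : forall c : 'I_m, exists j : 'I_n, b j = c /\ z j != 0.
    by move=> c; have [j] := b_onto c; exists j.
  by exists (finfun h) => c; rewrite ffunE.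
rewrite (bigD1 f0) //= ltr_pwDl //.
  rewrite mulr_gt0 ?Wdet //; last by move=> i; case: (f0P i).
  by apply: prodr_gt0 => i _; have [bi zi] := f0P i; rewrite mxE bi eqxx normr_gt0.
apply: sumr_ge0 => f _.
have [bf|bf] := pselect (forall i, b (f i) = i).
  by rewrite mulr_ge0 // ltW // Wdet.
have [i bi] : exists i, b (f i) != i.
  apply: contrapT => h; apply: bf => i.
  by apply/eqP/negPn/negP => k; apply: h; exists i.
by rewrite (bigD1 i) //= mxE (negbTE bi) mul0r mul0r.
Qed.

(* The square matrix [B u | B] is singular, and the terms of the expansion of its
   determinant along the first column all have the same sign. *)
Lemma alternating_image_eq0 (R : realFieldType) (m : nat)
    (B : 'M[R]_(m.+1, m)) (u : 'cV[R]_m) (e : nat) :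
  (forall i, 0 < \det (row' i B)) ->
  (forall i : 'I_m.+1, 0 <= (-1) ^+ (e + i) * (B *m u) i 0) ->
  B *m u = 0.
Proof.
move=> Bpos Balt; set y := B *m u.
pose C : 'M[R]_(m.+1, 1 + m) := row_mx y B.
have vC : row_mx (1%:M : 'M[R]_1) (- u^T) *m C^T = 0.
  by rewrite /C tr_row_mx mul_row_col mul1mx mulNmx -trmx_mul subrr.
have C0 : \det (C : 'M[R]_m.+1) = 0.
  rewrite -det_tr; apply/eqP/det0P.
  exists (row_mx (1%:M : 'M[R]_1) (- u^T)); last exact: vC.
  apply/eqP => /(congr1 (fun M : 'rV[R]_(1 + m) => M 0 (lshift m 0))).
  by rewrite (row_mxEl _ _ 0 0) !mxE /= => /eqP; rewrite oner_eq0.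
move: C0; rewrite (expand_det_col _ 0).
have CE i : (C : 'M[R]_m.+1) i 0 * cofactor (C : 'M[R]_m.+1) i 0
    = (-1) ^+ i * y i 0 * \det (row' i B).
  rewrite /cofactor addn0.
  have -> : (C : 'M[R]_m.+1) i 0 = y i 0.
    have -> : (0 : 'I_m.+1) = lshift m (0 : 'I_1) by exact: val_inj.
    exact: row_mxEl.
  have -> : row' i (col' 0 (C : 'M[R]_m.+1)) = row' i B.
    apply/matrixP => a c; rewrite !mxE.
    have -> : lift 0 c = rshift 1 c by exact: val_inj.
    by case: splitP => [[[|//] ?]//|c' /= [] /val_inj ->].
  by rewrite mulrA (mulrC (y i 0)).
under eq_bigr => i _ do rewrite CE.
move=> S0.
have : \sum_(i < m.+1) ((-1) ^+ (e + i) * y i 0 * \det (row' i B)) = 0.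
  transitivity ((-1) ^+ e * \sum_(i < m.+1) (-1) ^+ i * y i 0 * \det (row' i B)).
    by rewrite big_distrr /=; apply: eq_bigr => i _; rewrite exprD !mulrA.
  by rewrite S0 mulr0.
move/eqP; rewrite psumr_eq0; last by move=> i _; rewrite mulr_ge0 // ltW.
move=> /allP H; apply/matrixP => i j; rewrite [j]ord1 [RHS]mxE; apply/eqP.
have := H i (mem_index_enum _).
by rewrite implyTb mulf_eq0 (gt_eqF (Bpos i)) orbF mulf_eq0 signr_eq0.
Qed.

(** This is S^+(A z) <= S^-(z). Write [z = W *m u] with [u] a vector of alternating signs, one per
    block. Too many alternating entries of [A *m z] would give a matrix [B] with one row more than
    columns, positive maximal minors and an alternating image [B *m u]; then [B *m u = 0], hence
    [u = 0], which is absurd. *)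
Lemma variation_diminishing (R : realType) (n : nat) (z : 'cV[R]_n) : z != 0 ->
  exists m, strictly_alternating m z /\
    forall A, totally_positive A -> ~ weakly_alternating m.+1 (A *m z).
Proof.
move=> z0.
pose zn (j : nat) := oapp (fun i : 'I_n => z i 0) 0 (insub j).
have znE (j : 'I_n) : zn j = z j 0 by rewrite /zn valK.
have [|m [b [e [bmono bm bz bex]]]] := @sign_blocks R zn n.
  have [j zj] : exists j : 'I_n, z j 0 != 0.
    apply: contrapT => h; move/eqP: z0; apply; apply/matrixP => i j.
    by rewrite [j]ord1 mxE; apply/eqP/negPn/negP => k; apply: h; exists i.
  by exists j => //; rewrite znE.
exists m.+1.
have rep (c : 'I_m.+1) : exists2 j : 'I_n, b j = c & z j 0 != 0.
  have [j [jn bj zj]] := bex c (ltn_ord c).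
  by exists (Ordinal jn); rewrite // -znE.
have zge (j : 'I_n) : 0 <= (-1) ^+ (e + b j) * z j 0 by rewrite -znE bz.
split.
  have /choice[h hP] : forall c : 'I_m.+1, exists j : 'I_n, b j = c /\ z j 0 != 0.
    by move=> c; have [j] := rep c; exists j.
  exists e, h; split.
    move=> i j ij; rewrite ltnNge; apply/negP => /bmono /(_ (ltn_ord _)).
    by rewrite (proj1 (hP i)) (proj1 (hP j)) leqNgt ij.
  move=> i; have [bi zi] := hP i.
  by rewrite lt0r mulf_neq0 ?signr_eq0 //= -{1}bi zge.
move=> A A_TP [e' [r [rmono ry]]].
pose W := block_abs m.+1 b (fun j => z j 0).
pose u : 'cV[R]_m.+1 := \col_c (-1) ^+ (e + c).
have Wu : W *m u = z.
  apply/matrixP => j k; rewrite [k]ord1 mxE.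
  have bj : (b j < m.+1)%N by exact: bm.
  rewrite (bigD1 (Ordinal bj)) //= big1 ?addr0.
    rewrite !mxE eqxx /=.
    rewrite (_ : `|z j 0| = (-1) ^+ (e + b j) * z j 0).
      by rewrite mulrAC -expr2 sqrr_sign mul1r.
    by rewrite -[RHS](ger0_norm (zge j)) normrM normrX normrN1 expr1n mul1r.
  move=> c cj; rewrite !mxE ifN ?mul0r //.
  by apply: contra cj => /eqP bjc; apply/eqP/val_inj.
pose B := rowsub r A *m W.
have Bu : B *m u = rowsub r (A *m z).
  rewrite /B -mulmxA Wu; apply/matrixP => i j; rewrite !mxE.
  by apply: eq_bigr => k _; rewrite mxE.
have Bpos i : 0 < \det (row' i B).
  have -> : row' i B = rowsub (fun k => r (lift i k)) A *m W.
    by apply/matrixP => k l; rewrite !mxE; apply: eq_bigr => ? _; rewrite !mxE.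
  apply: det_block_abs_gt0 => //.
    by move=> k l kl; exact: bmono.
  move=> k l kl; apply: rmono.
  by rewrite /= /bump; move: kl; case: leqP; case: leqP => /=; lia.
have /= Bu0 : B *m u = 0.
  apply: (@alternating_image_eq0 _ _ _ _ e') => // i.
  by rewrite Bu mxE; exact: ry.
have : row' 0 B *m u = 0.
  have -> : row' 0 B *m u = row' 0 (B *m u).
    apply/matrixP => i j; rewrite [LHS]mxE [RHS]mxE [RHS]mxE.
    by apply: eq_bigr => k _; rewrite [in LHS]mxE.
  by rewrite Bu0; apply/matrixP => i j; rewrite !mxE.
have Binv : row' 0 B \in unitmx by rewrite unitmxE unitfE gt_eqF.
move/(congr1 (mulmx (invmx (row' 0 B)))); rewrite mulKmx // mulmx0.
move/matrixP/(_ 0 0); rewrite !mxE => /eqP.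
by rewrite signr_eq0.
Qed.

(** * Absolute continuity and Gronwall's inequality *)

(** A supremum argument in the role of Cousin's lemma: it yields partitions whose pieces are as
    short as the point [t] inside or next to them demands. *)
Lemma interval_induction (R : realType) (a b : R) (P : R -> Prop) :
  a <= b -> P a ->
  (forall t, a <= t <= b -> exists2 d, 0 < d & forall u v,
     a <= u <= t -> t <= v <= b -> t - u < d -> v - t < d -> P u -> P v) ->
  P b.
Proof.
move=> ab Pa step; pose S := [set c | a <= c <= b /\ P c].
have Sa : S a by split; rewrite ?lexx.
have Sb : ubound S b by move=> c [/andP[]].
have supS : has_sup S by split; [exists a|exists b].
have ubS : has_ubound S by exists b.
have as_ : a <= sup S by exact: ub_le_sup.
have sb : sup S <= b by apply: ge_sup => //; exists a.
have [|d d0 sP] := step (sup S); first by rewrite as_ sb.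
have [u [/andP[au ub] Pu] su] := sup_adherent d0 supS.
have us : u <= sup S by apply: ub_le_sup => //; split; rewrite ?au.
have [sd|sd] := leP (sup S + d / 2) b.
  have : sup S + d / 2 <= sup S.
    apply: ub_le_sup => //.
    split; first by apply/andP; split; lra.
    by apply: (sP u) => //; first [apply/andP; split; lra | lra].
  by move=> ?; lra.
by apply: (sP u) => //; first [apply/andP; split; lra | lra].
Qed.

Lemma ae_impl (R : realType) (P Q : R -> Prop) : (forall t, P t -> Q t) ->
  (\forall t \ae (@lebesgue_measure R), P t) ->
  \forall t \ae (@lebesgue_measure R), Q t.
Proof. by move=> PQ; apply: negligibleS => t /= + /PQ. Qed.

Lemma ae_and (R : realType) (P Q : R -> Prop) :
  (\forall t \ae (@lebesgue_measure R), P t) ->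
  (\forall t \ae (@lebesgue_measure R), Q t) ->
  \forall t \ae (@lebesgue_measure R), P t /\ Q t.
Proof.
move=> nP nQ; apply: negligibleS (negligibleU nP nQ) => t /= /not_andP[].
  by left.
by right.
Qed.

Lemma le_lebesgue_measure (R : realType) (A B : set R) :
  measurable A -> measurable B -> A `<=` B ->
  (lebesgue_measure A <= lebesgue_measure B)%E.
Proof. by move=> mA mB AB; apply: le_measure => //; rewrite inE. Qed.

Lemma negligible_open_cover (R : realType) (N : set R) (e : R) : 0 < e ->
  (@lebesgue_measure R).-negligible N ->
  exists U : set R, [/\ open U, N `<=` U & (lebesgue_measure U < e%:E)%E].
Proof.
move=> e0 [A [mA A0 NA]].
have [|U [oU AU UA]] := lebesgue_regularity_outer mA _ e0.
  by apply: (@le_lt_trans _ _ 0%E); [rewrite -A0|].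
exists U; split => //; first exact: subset_trans AU.
rewrite -(setDUK AU) (le_lt_trans (measureU2 _ _ _)) //.
  by apply: measurableD => //; exact: open_measurable.
by rewrite [X in (X + _)%E]A0 add0e.
Qed.

Lemma is_derive_local_lipschitz (R : realType) (V : normedModType R)
    (F : R -> V) (t : R) (D : V) (e : R) :
  is_derive (t : R^o) 1 (F : R^o -> V) D -> 0 < e ->
  exists2 d, 0 < d & forall s, `|s - t| < d ->
    `|F s - F t| <= (`|D| + e) * `|s - t|.
Proof.
move=> [dF DF] e0.
have : (fun h => h^-1 *: ((F \o shift t) (h *: (1 : R^o)) - F t)) @ 0^' --> D.
  by rewrite -DF; exact: dF.
move=> /cvgrPdist_lt/(_ _ e0)[d /= d0 dP]; exists d => // s sd.
have [->|st] := eqVneq s t; first by rewrite !subrr !normr0 mulr0.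
have := dP (s - t); rewrite /= sub0r normrN subr_eq0 => /(_ sd st).
rewrite scaler1 subrK => /ltW h.
have -> : F s - F t = (s - t) *: ((s - t)^-1 *: (F s - F t)).
  by rewrite scalerA divff ?scale1r // subr_eq0.
rewrite normrZ mulrC ler_wpM2r // -lerBlDl.
by rewrite (le_trans _ h) // distrC lerB_dist.
Qed.

(** Lists can grow by one interval at a time, as the covering argument requires; the rightmost
    interval stands at the head. *)
Lemma abs_continuous_seq (R : realType) (V : normedModType R) (a b : R)
    (F : R -> V) (e : R) : abs_continuous a b F -> 0 < e ->
  exists2 d, 0 < d & forall s : seq (R * R),
    all (fun x => [&& a <= x.1, x.1 <= x.2 & x.2 <= b]) s ->
    pairwise (fun x y => y.2 <= x.1) s ->
    \sum_(x <- s) (x.2 - x.1) < d ->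
    \sum_(x <- s) `|F x.2 - F x.1| < e.
Proof.
move=> acF e0; have [d d0 dP] := acF e e0; exists d => // s s_ab s_dis.
rewrite !(big_nth (0, 0)) !big_mkord => s_d.
apply: dP (fun i : 'I__ => (nth (0, 0) s i).1) (fun i => (nth (0, 0) s i).2) _ _ s_d.
  by move=> i; have /andP[? /andP[]] := all_nthP (0, 0) s_ab i (ltn_ord i).
move=> i j ij; move: s_dis => /(pairwiseP (0, 0)) s_dis.
have [ltij|ltji|eqij] := ltngtP i j.
- by right; apply: s_dis => //; rewrite inE.
- by left; apply: s_dis => //; rewrite inE.
- by move/eqP: ij => []; exact: val_inj.
Qed.

Lemma abs_continuous_le (R : realType) (V : normedModType R) (a b a' b' : R)
    (F : R -> V) : a <= a' -> b' <= b ->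
  abs_continuous a b F -> abs_continuous a' b' F.
Proof.
move=> aa bb acF e e0; have [d d0 dP] := acF e e0; exists d => // m u v uv.
apply: dP => i; have [? [? ?]] := uv i.
by split; [exact: le_trans aa _|split => //; exact: le_trans bb].
Qed.

(* Cut [a, b] into intervals that are either short enough around a point of
   differentiability or contained in a small open cover of the exceptional null
   set; absolute continuity makes the latter contribute at most [e]. *)
Lemma abs_continuous_lipschitz (R : realType) (V : normedModType R)
    (a b K : R) (F : R -> V) : a <= b -> 0 <= K -> abs_continuous a b F ->
  (\forall t \ae (@lebesgue_measure R), t \in `[a, b] ->
     exists2 D, is_derive (t : R^o) 1 (F : R^o -> V) D & `|D| <= K) ->
  `|F b - F a| <= K * (b - a).
Proof.
move=> ab K0 acF [N [mN N0 NP]].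
have good t : a <= t <= b -> ~ N t ->
    exists2 D, is_derive (t : R^o) 1 (F : R^o -> V) D & `|D| <= K.
  by move=> tab nNt; apply: contrapT => h; apply: nNt; apply: NP => /= /(_ tab).
suff H e : 0 < e -> `|F b - F a| <= (K + e) * (b - a) + e.
  apply/ler_addgt0Pr => e e0.
  (* This value multiplied by [b - a], plus itself, is exactly [e]; the summand 1 covers [a = b]. *)
  have e'0 : 0 < e / (b - a + 1) by rewrite divr_gt0 //; lra.
  rewrite (le_trans (H _ e'0)) // mulrDl -addrA lerD2l.
  by have -> : e / (b - a + 1) * (b - a) + e / (b - a + 1) = e by field; lra.
move=> e0.
have [d d0 acd] := abs_continuous_seq acF e0.
have [|U [oU NU Ud]] := @negligible_open_cover R N d d0.
  by exists N; split.
have mU : measurable U by exact: open_measurable.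
have mI u : measurable (U `&` `[a, u]) by apply: measurableI.
(* [s] lists the pieces inside [U]. Bounding their total length by the measure of [U] up to [c]
   keeps it below [d], whatever the number of pieces. *)
pose P c := exists s : seq (R * R),
  [/\ all (fun x => [&& a <= x.1, x.1 <= x.2 & x.2 <= c]) s,
      pairwise (fun x y => y.2 <= x.1) s,
      ((\sum_(x <- s) (x.2 - x.1))%:E <= lebesgue_measure (U `&` `[a, c]))%E &
      `|F c - F a| <= (K + e) * (c - a) + \sum_(x <- s) `|F x.2 - F x.1| ].
suff [s [s_ab s_dis sU /le_trans->//]] : P b.
  have : \sum_(x <- s) (x.2 - x.1) < d.
    rewrite -lte_fin (le_lt_trans sU) // (le_lt_trans _ Ud) //.
    by apply: le_lebesgue_measure => // x [].
  by move=> /(acd _ s_ab s_dis)/ltW ?; rewrite lerD2l.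
apply: (@interval_induction _ a b P) => //.
  exists [::]; rewrite !big_nil; split => //.
  by rewrite !subrr normr0 mulr0 addr0.
move=> t tab; have [Nt|nNt] := pselect (N t).
  have [r r0 rU] : exists2 r, 0 < r & ball t r `<=` U.
    by have /nbhs_ballP[r /= r0 rU] := oU t (NU t Nt); exists r.
  exists r => // u v /andP[au ut] /andP[tv vb] tur vtr [s [s_ab s_dis sU sF]].
  exists ((u, v) :: s); split.
  - rewrite /= au lexx (le_trans ut tv) /=; apply: sub_all s_ab => x /and3P[-> ->] /=.
    by move=> /le_trans; apply; lra.
  - by rewrite /= s_dis andbT; apply: sub_all s_ab => x /and3P[].
  (* The new piece is taken half-open, hence disjoint from [[a, u]], so that the measures add. *)
  - rewrite big_cons /= EFinD addeC.
    apply: (@le_trans _ _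
      (lebesgue_measure (U `&` `[a, u]) + lebesgue_measure `]u, v]))%E.
      rewrite leeD // lebesgue_measure_itv /= lte_fin; case: ltP => //.
      by move=> ?; rewrite lee_fin; lra.
    rewrite -measureU //.
      apply: le_lebesgue_measure => //; first exact: measurableU.
      move=> x [[Ux]|] /=; rewrite !in_itv /=.
        by move=> /andP[ax xu]; split => //; rewrite ax; lra.
      move=> /andP[ux xv]; split; last by apply/andP; split; lra.
      by apply: rU; rewrite /ball /= ltr_norml; apply/andP; split; lra.
      exact: mI.
    rewrite -subset0 => x [[_]] /=; rewrite !in_itv /= => /andP[_ xu] /andP[ux _].
    lra.
  - rewrite big_cons /=.
    have := ler_distD (F u) (F v) (F a).
    have : (K + e) * (u - a) <= (K + e) * (v - a).
      by rewrite ler_wpM2l; lra.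
    by move=> ? ?; lra.
have [D DF DK] := good t tab nNt.
have [r r0 rP] := is_derive_local_lipschitz DF e0.
exists r => // u v /andP[au ut] /andP[tv vb] tur vtr [s [s_ab s_dis sU sF]].
exists s; split => //.
- apply: sub_all s_ab => x /and3P[-> ->] /=.
  by move=> /le_trans; apply; lra.
- apply: le_trans sU _; apply: le_lebesgue_measure => //.
  move=> x [Ux] /=; rewrite !in_itv /= => /andP[ax xu]; split => //.
  by rewrite ax; lra.
- have ru := rP u; rewrite distrC ger0_norm ?subr_ge0 // in ru.
  have rv := rP v; rewrite ger0_norm ?subr_ge0 // in rv.
  have {}ru := ru tur; have {}rv := rv vtr.
  have := ler_distD (F u) (F v) (F a).
  have := ler_distD (F t) (F v) (F u).
  rewrite (distrC (F t)).
  have : (`|D| + e) * (v - t) <= (K + e) * (v - t) by rewrite ler_wpM2r; lra.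
  have : (`|D| + e) * (t - u) <= (K + e) * (t - u) by rewrite ler_wpM2r; lra.
  by move=> *; lra.
Qed.


Lemma abs_continuous_within (R : realType) (V : normedModType R) (a b : R)
    (F : R -> V) : abs_continuous a b F -> {within `[a, b], continuous F}.
Proof.
move=> acF; apply/subspace_continuousP => x /=; rewrite in_itv /= => xab.
apply/cvgrPdist_lt => e e0; have [d d0 dP] := abs_continuous_seq acF e0.
near=> y.
have yab : y \in `[a, b] by near: y; exact: withinT.
have yx : `|x - y| < d.
  by near: y; apply: cvg_within; apply/nbhs_ballP; exists d.
move: yab; rewrite in_itv /= => yab.
have [xy|xy] := leP x y.
  have := dP [:: (x, y)]; rewrite !big_cons !big_nil !addr0 /= distrC; apply => //.
    by rewrite xy; case/andP: xab => ->; case/andP: yab => _ ->.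
  by move: yx; rewrite distrC ger0_norm ?subr_ge0.
have := dP [:: (y, x)]; rewrite !big_cons !big_nil !addr0 /=; apply => //.
  by rewrite (ltW xy); case/andP: yab => ->; case/andP: xab => _ ->.
by move: yx; rewrite ger0_norm // subr_ge0 ltW.
Unshelve. all: by end_near. Qed.

(** At a maximum [c] of the norm, the increment from [a] is at most [M * |z c| * (c - a)], that is,
    at most half of [|z c|]; so [|z c| <= 2 * |z a|]. *)
Lemma gronwall_step (R : realType) (V : normedModType R) (a b M : R)
    (z : R -> V) : a <= b -> 0 < M -> b - a <= (2 * M)^-1 ->
  abs_continuous a b z ->
  (\forall t \ae (@lebesgue_measure R), t \in `[a, b] ->
     exists2 D, is_derive (t : R^o) 1 (z : R^o -> V) D & `|D| <= M * `|z t|) ->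
  `|z b| <= 2 * `|z a|.
Proof.
move=> ab M0 abM acz dz.
have cz : {within `[a, b], continuous (fun t => `|z t|)}.
  have := abs_continuous_within acz; move=> cz x.
  exact: (continuous_comp (cz x) (@norm_continuous _ _ _)).
have [c cab cmax] := EVT_max ab cz.
have cab' := cab; move: cab'; rewrite in_itv /= => /andP[ac cb].
have : `|z c - z a| <= M * `|z c| * (c - a).
  apply: abs_continuous_lipschitz => //; first by rewrite mulr_ge0 // ltW.
    exact: abs_continuous_le acz.
  apply: ae_impl dz => t dz tac.
  have tab : t \in `[a, b].
    by move: tac; rewrite !in_itv /= => /andP[-> tc]; rewrite (le_trans tc).
  have [D DF DM] := dz tab; exists D => //.
  by rewrite (le_trans DM) // ler_pM2l // cmax.
have : M * `|z c| * (c - a) <= `|z c| / 2.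
  have : M * `|z c| * (c - a) <= M * `|z c| * (2 * M)^-1.
    by rewrite ler_wpM2l ?mulr_ge0 ?(ltW M0) //; lra.
  by have -> : M * `|z c| * (2 * M)^-1 = `|z c| / 2 by field; rewrite gt_eqF.
have := cmax b; rewrite in_itv /= ab lexx => /(_ isT).
have := ler_distD 0 (z c) (z a); rewrite subr0 sub0r normrN.
have := lerB_dist (z c) (z a).
by move=> *; lra.
Qed.

(** The short-interval estimate is chained [k] times, each step costing a factor 2; the power of 2
    replaces the exponential. *)
Lemma gronwall (R : realType) (V : normedModType R) (a M : R) (k : nat)
    (z : R -> V) (b : R) : a <= b -> 0 < M -> b - a <= k%:R * (2 * M)^-1 ->
  abs_continuous a b z ->
  (\forall t \ae (@lebesgue_measure R), t \in `[a, b] ->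
     exists2 D, is_derive (t : R^o) 1 (z : R^o -> V) D & `|D| <= M * `|z t|) ->
  `|z b| <= 2 ^+ k * `|z a|.
Proof.
move=> + M0; elim: k b => [|k IHk] b ab.
  rewrite mul0r => ba _ _; have -> : b = a by lra.
  by rewrite expr0 mul1r.
rewrite -natr1 mulrDl mul1r => bak acz dz.
have h0 : 0 < (2 * M)^-1 by rewrite invr_gt0 mulr_gt0.
have [bah|bah] := leP (b - a) (2 * M)^-1.
  apply: (le_trans (gronwall_step ab M0 bah acz dz)).
  by rewrite exprS -mulrA ler_pM2l // ler_peMl // exprn_ege1 // ler1n.
pose c := b - (2 * M)^-1.
have ac : a <= c by rewrite /c; lra.
have cb : c <= b by rewrite /c; lra.
have dz' u v : a <= u -> v <= b ->
    \forall t \ae (@lebesgue_measure R), t \in `[u, v] ->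
     exists2 D, is_derive (t : R^o) 1 (z : R^o -> V) D & `|D| <= M * `|z t|.
  move=> au vb; apply: ae_impl dz => t + tuv; apply.
  move: tuv; rewrite !in_itv /= => /andP[ut tv].
  by rewrite (le_trans au ut) (le_trans tv vb).
have : `|z c| <= 2 ^+ k * `|z a|.
  apply: IHk => //; first by rewrite /c; lra.
    exact: abs_continuous_le acz.
  exact: dz'.
have : `|z b| <= 2 * `|z c|.
  apply: (@gronwall_step _ _ c b M) => //; first by rewrite /c; lra.
    exact: abs_continuous_le acz.
  exact: dz'.
by rewrite exprS -mulrA => *; lra.
Qed.

Lemma negligible_shift (R : realType) (T : R) (N : set R) :
  (@lebesgue_measure R).-negligible N ->
  (@lebesgue_measure R).-negligible [set t | N (t + T)].
Proof.
move=> [A [mA A0 NA]].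
have mf : measurable_fun [set: measurableTypeR R]
    ((fun t => t + T) : measurableTypeR R -> measurableTypeR R).
  exact: measurable_funD.
exists ((fun t => t + T) @^-1` A); split.
- by rewrite -[X in measurable X]setTI; exact: mf.
(* Translation invariance comes from uniqueness: the pushforward gives half-open intervals their
   length. *)
- rewrite -A0; symmetry.
  apply: (@lebesgue_measure_unique R
    (measure_function_pushforward__canonical__measure_function_Measure
       lebesgue_measure mf)) => //.
  move=> X /ocitvP[->|[[a b] /= ab ->]]; first by rewrite !measure0.
  rewrite /pushforward /=.
  have -> : (fun t => t + T) @^-1` `]a, b]%classic = `]a - T, b - T]%classic.
    by apply/seteqP; split => x /=; rewrite !in_itv /= ltrBlDr lerBrDr.
  rewrite !lebesgue_measure_itv /= !lte_fin ltrBlDr subrK.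
  by case: ifP => // _; rewrite -!EFinB; congr EFin; lra.
- by move=> t /= /NA.
Qed.

Lemma ae_shift (R : realType) (T : R) (P : R -> Prop) :
  (\forall t \ae (@lebesgue_measure R), P t) ->
  \forall t \ae (@lebesgue_measure R), P (t + T).
Proof. exact: negligible_shift. Qed.

Lemma is_derive_shift (R : realType) (V : normedModType R)
    (F : R -> V) (t T : R) (D : V) :
  is_derive (t + T : R^o) 1 (F : R^o -> V) D ->
  is_derive (t : R^o) 1 ((fun s => F (s + T)) : R^o -> V) D.
Proof.
move=> [dF DF].
have E : (fun h : R^o => h^-1 *: (((fun s => F (s + T)) \o shift t) (h *: (1 : R^o))
      - (fun s => F (s + T)) t)) =
    (fun h : R^o => h^-1 *: ((F \o shift (t + T)) (h *: (1 : R^o)) - F (t + T))).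
  by apply/funext => h /=; rewrite addrA.
by split; [rewrite /derivable E|rewrite /derive E].
Qed.

(** * Mean value formula along lines *)

Lemma entry_le_norm (R : realType) (m n : nat) (M : 'M[R]_(m, n)) i j :
  `|M i j| <= `|M|.
Proof.
rewrite [leRHS]/Num.Def.normr /= mx_normrE.
exact: (le_bigmax _ (fun ij : 'I_m * 'I_n => `|M ij.1 ij.2|) (i, j)).
Qed.

Lemma norm_le_entries (R : realType) (m n : nat) (M : 'M[R]_(m, n)) (c : R) :
  0 <= c -> (forall i j, `|M i j| <= c) -> `|M| <= c.
Proof.
move=> c0 Mc; rewrite [leLHS]/Num.Def.normr /= mx_normrE.
by apply: bigmax_le => // -[i j] _; exact: Mc.
Qed.

Lemma norm_mulmx_le (R : realType) (m n p : nat) (A : 'M[R]_(m, n))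
    (B : 'M[R]_(n, p)) : `|A *m B| <= n%:R * `|A| * `|B|.
Proof.
apply: norm_le_entries => [|i j]; first by rewrite !mulr_ge0.
rewrite mxE (le_trans (ler_norm_sum _ _ _)) //.
apply: (@le_trans _ _ (\sum_(k < n) `|A| * `|B|)).
  by apply: ler_sum => k _; rewrite normrM ler_pM // entry_le_norm.
by rewrite sumr_const card_ord -mulrA mulr_natl.
Qed.

(** The factor [1 *] puts the bound in the shape [K * |x|] asked for linear maps below. *)
Lemma norm_trmx_le (R : realType) (m n : nat) (A : 'M[R]_(m, n)) :
  `|A^T| <= 1 * `|A|.
Proof.
by rewrite mul1r; apply: norm_le_entries => // i j; rewrite mxE entry_le_norm.
Qed.

Lemma is_derive_linear (R : realType) (V W : normedModType R)
    (L : {linear V -> W}) (K : R) (F : R -> V) (t : R) (D : V) :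
  (forall x, `|L x| <= K * `|x|) ->
  is_derive (t : R^o) 1 (F : R^o -> V) D ->
  is_derive (t : R^o) 1 ((fun s => L (F s)) : R^o -> W) (L D).
Proof.
move=> LK [dF DF].
have LC : {for D, continuous L}.
  apply/cvgrPdist_lt => e e0; near=> y.
  rewrite -linearB (le_lt_trans (LK _)) //.
  have K1 : 0 < `|K| + 1 by rewrite ltr_wpDl.
  rewrite (@le_lt_trans _ _ ((`|K| + 1) * `|D - y|)) //.
    by rewrite ler_wpM2r // (le_trans (ler_norm K)) // lerDl.
  rewrite mulrC -ltr_pdivlMr //.
  near: y; apply/nbhs_ballP; exists (e / (`|K| + 1)); first by rewrite /= divr_gt0.
  by move=> y; rewrite -ball_normE.
have E : (fun h : R^o => h^-1 *: (((fun s => L (F s)) \o shift t) (h *: (1 : R^o))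
      - L (F t))) =
    L \o (fun h : R^o => h^-1 *: ((F \o shift t) (h *: (1 : R^o)) - F t)).
  apply/funext => h /=.
  rewrite linearZ_LR; congr (_ *: _); exact/esym/linearB.
have cL : (fun h : R^o => h^-1 *: (((fun s => L (F s)) \o shift t) (h *: (1 : R^o))
      - L (F t)))
    @ 0^' --> L D.
  rewrite E; apply: continuous_cvg => //; rewrite -DF; exact: dF.
split; first by apply/cvg_ex; exists (L D).
exact: cvg_lim cL.
Unshelve. all: by end_near. Qed.

Lemma abs_continuous_linear (R : realType) (V W : normedModType R)
    (L : {linear V -> W}) (K : R) (F : R -> V) (a b : R) :
  (forall x, `|L x| <= K * `|x|) ->
  abs_continuous a b F -> abs_continuous a b (fun s => L (F s)).
Proof.
move=> LK acF e e0.
have K1 : 0 < `|K| + 1 by rewrite ltr_wpDl.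
have [d d0 dP] := acF _ (divr_gt0 e0 K1); exists d => // m u v ab uv uvd.
have := dP m u v ab uv uvd; rewrite ltr_pdivlMr // mulrC; apply: le_lt_trans.
rewrite mulr_sumr; apply: ler_sum => i _; rewrite -linearB.
rewrite (le_trans (LK _)) // ler_wpM2r // (le_trans (ler_norm K)) // lerDl //.
Qed.

Lemma abs_continuousB (R : realType) (V : normedModType R) (F G : R -> V)
    (a b : R) : abs_continuous a b F -> abs_continuous a b G ->
  abs_continuous a b (fun s => F s - G s).
Proof.
move=> acF acG e e0.
have [d d0 dP] := acF _ (divr_gt0 e0 (ltr0n _ 2)).
have [d' d'0 d'P] := acG _ (divr_gt0 e0 (ltr0n _ 2)).
exists (Num.min d d'); first by rewrite lt_min d0.
move=> m u v ab uv; rewrite lt_min => /andP[/(dP m u v ab uv) h1 /(d'P m u v ab uv) h2].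
apply: (@le_lt_trans _ _
    (\sum_(i < m) `|F (v i) - F (u i)| + \sum_(i < m) `|G (v i) - G (u i)|)).
  rewrite -big_split /=; apply: ler_sum => i _.
  have -> : F (v i) - G (v i) - (F (u i) - G (u i)) =
      (F (v i) - F (u i)) - (G (v i) - G (u i)).
    by rewrite !opprD !opprK addrACA.
  exact: ler_normB.
by rewrite [e]splitr ltrD.
Qed.

(** The order of quantifiers is the point: [C] depends on [n], [b] and [M] alone and serves all
    coefficient matrices and solutions. *)
Lemma linear_ode_bound (R : realType) (n : nat) (b M : R) :
  exists C : R, forall (a c : R) (A : R -> 'M[R]_n) (z : R -> 'cV[R]_n),
    a <= c -> c - a <= b -> abs_continuous a c z ->
    (\forall t \ae (@lebesgue_measure R), t \in `[a, c] ->
      is_derive (t : R^o) 1 (z : R^o -> 'cV[R]_n) (A t *m z t)) ->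
    (\forall t \ae (@lebesgue_measure R), t \in `[a, c] -> `|A t| <= M) ->
    `|z c| <= C * `|z a|.
Proof.
(* The factor [n] comes from the entrywise maximum norm of a product, and the summand 1 makes the
   rate positive. *)
pose M' := n%:R * `|M| + 1.
have M'0 : 0 < M' by rewrite ltr_wpDl // mulr_ge0.
have [k bk] : exists k : nat, b * (2 * M') <= k%:R.
  exists (Num.truncn `|b * (2 * M')|).+1.
  rewrite (le_trans (ler_norm _)) // ltW //.
  exact: truncnS_gt.
exists (2 ^+ k) => a c A z ac cab acz dz AM.
apply: (@gronwall _ _ a M') => //.
  by rewrite (le_trans cab) // ler_pdivlMr // mulr_gt0.
apply: ae_impl (ae_and dz AM) => t [Dz tM] tac.
exists (A t *m z t); first exact: Dz.
rewrite (le_trans (norm_mulmx_le _ _)) // ler_wpM2r // /M'.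
rewrite (@le_trans _ _ (n%:R * `|M|)) ?lerDl // ler_wpM2l //.
by rewrite (le_trans (tM tac)) // ler_norm.
Qed.

Lemma lineE (R : realType) (n : nat) (p q : 'rV[R]_n) (r : R) :
  line p q r = r *: (p - q) + q.
Proof. by rewrite /line scalerBr scalerBl scale1r addrCA addrC -addrA [- _ + _]addrC. Qed.

Lemma line_same (R : realType) (n : nat) (p : 'rV[R]_n) (r : R) :
  line p p r = p.
Proof. by rewrite lineE subrr scaler0 add0r. Qed.

Lemma line_convex (R : realType) (n : nat) (Omega : set 'rV[R]_n)
    (p q : 'rV[R]_n) (r : R) : convex_set Omega -> Omega p -> Omega q ->
  0 <= r <= 1 -> Omega (line p q r).
Proof.
move=> cO Op Oq /andP[r0 r1].
have r01 : Itv.spec (Itv.num_sem (R:=R)) (Itv.Real `[0%Z, 1%Z]) r.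
  by rewrite /= /Itv.num_sem /= realE r0 /= in_itv /= r0.
have := cO p q (Itv.mk r01); rewrite !inE => /(_ Op Oq).
by [].
Qed.

(** The difference quotients along the line are literally those of [g] at [line p q r] in the
    direction [p - q], so no chain rule enters. *)
Lemma is_derive_line (R : realType) (n : nat) (g : 'rV[R]_n -> 'rV[R]_n)
    (p q : 'rV[R]_n) (r : R) : differentiable g (line p q r) ->
  is_derive (r : R^o) 1 ((fun s => g (line p q s)) : R^o -> 'rV[R]_n)
    ((p - q) *m (Jac g (line p q r))^T).
Proof.
move=> dg.
have E : (fun h : R^o => h^-1 *: (((fun s => g (line p q s)) \o shift r) (h *: (1 : R^o))
      - (fun s => g (line p q s)) r)) =
    (fun h : R^o => h^-1 *: ((g \o shift (line p q r)) (h *: (p - q)) - g (line p q r))).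
  apply/funext => h /=; congr (_ *: (g _ - _)).
  by rewrite !lineE scaler1 scalerDl addrA.
rewrite /Jac trmxK -deriveEjacobian //; split; last by rewrite /derive E.
rewrite /derivable E; exact: diff_derivable.
Qed.

Lemma is_derive_entry (R : realType) (m n : nat) (F : R -> 'M[R]_(m, n))
    (t : R) (D : 'M[R]_(m, n)) i j :
  is_derive (t : R^o) 1 (F : R^o -> 'M[R]_(m, n)) D ->
  is_derive (t : R^o) 1 ((fun s => F s i j) : R^o -> R^o) (D i j).
Proof.
move=> [dF <-]; rewrite derive_mx // mxE; split => //.
by move/derivable_mxP : dF => /(_ i j).
Qed.

Lemma withinP (T U : topologicalType) (A : set T) (f : T -> U) :
  (forall x, A x -> f y @[y --> within A (nbhs x)] --> f x) <->
  {within A, continuous f}.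
Proof. by split => [h|/subspace_continuousP //]; apply/subspace_continuousP. Qed.

Lemma cvg_sum_seq (R : numFieldType) (V : normedModType R) (T I : Type)
    (F : set_system T) (s : seq I) (f : I -> T -> V) (l : I -> V) :
  Filter F -> (forall i, f i @ F --> l i) ->
  (\sum_(i <- s) f i x) @[x --> F] --> \sum_(i <- s) l i.
Proof.
move=> FF fl; elim: s => [|i s IHs].
  have -> : (fun x => \sum_(i <- [::]) f i x) = cst 0.
    by apply/funext => x; rewrite big_nil.
  by rewrite big_nil; exact: cvg_cst.
have -> : (fun x => \sum_(i <- i :: s) f i x) = f i \+ (fun x => \sum_(i <- s) f i x).
  by apply/funext => x; rewrite big_cons.
by rewrite big_cons; exact: cvgD.
Qed.

Lemma Rintegral_sum (d : measure_display) (T : measurableType d) (R : realType)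
    (mu : {measure set T -> \bar R}) (D : set T) (I : Type) (s : seq I)
    (f : I -> T -> R) : measurable D ->
  (forall i, mu.-integrable D (EFin \o f i)) ->
  \int[mu]_(x in D) (\sum_(i <- s) f i x) = \sum_(i <- s) \int[mu]_(x in D) f i x.
Proof.
move=> mD fi.
have si (r : seq I) : mu.-integrable D (EFin \o (fun x => \sum_(i <- r) f i x)).
  have -> : EFin \o (fun x => \sum_(i <- r) f i x) =
      (fun x => \sum_(i <- r) (EFin \o f i) x)%E.
    by apply/funext => x /=; rewrite sumEFin.
  exact: integrable_sum.
elim: s => [|i s IHs].
  rewrite big_nil /Rintegral; under eq_integral do rewrite big_nil.
  by rewrite integral0.
rewrite big_cons -IHs -RintegralD //.
by apply: eq_Rintegral => x _; rewrite big_cons.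
Qed.

Lemma cvg_within_comp (T U V : topologicalType) (A : set T) (B : set U)
    (l : T -> U) (g : U -> V) (x : T) (y : V) :
  l @ x --> l x -> (forall s, A s -> B (l s)) ->
  g u @[u --> within B (nbhs (l x))] --> y ->
  g (l s) @[s --> within A (nbhs x)] --> y.
Proof.
move=> cl AB cg P /cg NP.
have h : nbhs x (l @^-1` [set u | B u -> P (g u)]) := cl _ NP.
change (nbhs x [set s | A s -> P (g (l s))]).
by apply: filterS h => s sP As; exact: (sP (AB s As)).
Qed.

Lemma within_continuousMr (R : realType) (A : set R) (f : R -> R) (c : R) :
  {within A, continuous f} -> {within A, continuous (fun r => f r * c)}.
Proof.
move=> /withinP cf; apply/withinP => r Ar.
by apply: cvgM; [exact: cf|exact: cvg_cst].
Qed.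

Lemma within_continuous_sum (R : realType) (A : set R) (I : Type) (s : seq I)
    (f : I -> R -> R) : (forall i, {within A, continuous f i}) ->
  {within A, continuous (fun r => \sum_(i <- s) f i r)}.
Proof.
move=> cf; apply/withinP => r Ar; apply: cvg_sum_seq => i.
by move: (cf i) => /withinP; apply.
Qed.

Lemma Jac_line_continuous (R : realType) (n : nat) (Omega : set 'rV[R]_n)
    (g : 'rV[R]_n -> 'rV[R]_n) (p q : 'rV[R]_n) i j :
  convex_set Omega -> C1_on Omega g -> Omega p -> Omega q ->
  {within `[0, 1], continuous (fun r : R => Jac g (line p q r) i j)}.
Proof.
move=> cO [_ /withinP cJ] Op Oq.
apply/withinP => r /=; rewrite in_itv /= => r01.
have Or := line_convex cO Op Oq r01.
suff cJl : Jac g (line p q s) @[s --> within `[0, 1] (nbhs r)] --> Jac g (line p q r).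
  exact: (cvg_comp _ _ cJl (@coord_continuous _ _ _ i j _)).
have cl : (fun s => line p q s) @ r --> line p q r.
  under eq_fun => s do rewrite lineE.
  rewrite lineE; apply: cvgD; last exact: cvg_cst.
  by apply: cvgZr_tmp; exact: cvg_id.
apply: (cvg_within_comp cl _ (cJ _ Or)) => s /=; rewrite in_itv /= => s01.
exact: line_convex.
Qed.

(** The fundamental theorem of calculus is applied to each component of [g (line p q r)], which runs
    from [g q] at [r = 0] to [g p] at [r = 1]. *)
Lemma mean_value_line (R : realType) (n : nat) (Omega : set 'rV[R]_n)
    (g : 'rV[R]_n -> 'rV[R]_n) (p q : 'rV[R]_n) :
  convex_set Omega -> C1_on Omega g -> Omega p -> Omega q ->
  (g p - g q)^T = (\matrix_(i, j) \int[@lebesgue_measure R]_(r in `[0, 1])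
     Jac g (line p q r) i j) *m (p - q)^T.
Proof.
move=> cO C1g Op Oq; apply/matrixP => i k.
rewrite [k]ord1 [LHS]mxE [LHS]mxE [X in _ + X]mxE.
pose h j (r : R) := Jac g (line p q r) i j * (p - q) 0 j.
have cJ j : {within `[0, 1], continuous (fun r : R => Jac g (line p q r) i j)}.
  exact: Jac_line_continuous cO C1g Op Oq.
have iJ j : (@lebesgue_measure R).-integrable `[0, 1]
    (EFin \o (fun r => Jac g (line p q r) i j)).
  by apply: continuous_compact_integrable => //; exact: segment_compact.
have ch j : {within `[0, 1], continuous h j} by exact: within_continuousMr.
have ih j : (@lebesgue_measure R).-integrable `[0, 1] (EFin \o h j).
  by apply: continuous_compact_integrable => //; exact: segment_compact.
have dF r : 0 <= r <= 1 ->
    is_derive (r : R^o) 1 ((fun s => g (line p q s) 0 i) : R^o -> R^o) (\sum_j h j r).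
  move=> r01.
  have Or := line_convex cO Op Oq r01.
  have := is_derive_entry 0 i (is_derive_line (C1g.1 _ Or)).
  rewrite mxE; under eq_bigr => j _ do rewrite [_^T _ _]mxE mulrC; exact.
have cF r : 0 <= r <= 1 -> {for r, continuous (fun s : R => g (line p q s) 0 i)}.
  move=> r01; have [dr _] := dF r r01.
  exact/differentiable_continuous/derivable1_diffP.
have := @continuous_FTC2 R (fun r => \sum_j h j r)
  (fun s => g (line p q s) 0 i) 0 1 ltr01.
have -> : line p q 1 = p by rewrite lineE scale1r subrK.
have -> : line p q 0 = q by rewrite lineE scale0r add0r.
move=> FTC.
have cs : {within `[0, 1], continuous (fun r : R => \sum_j h j r)}.
  exact: within_continuous_sum.
have {}FTC := FTC cs.
have dFoo : derivable_oo_LRcontinuous (fun s : R => g (line p q s) 0 i) 0 1.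
  split.
  - move=> r; rewrite in_itv /= => /andP[r0 r1].
    have r01 : 0 <= r <= 1 by rewrite !ltW.
    by case: (dF r r01).
  - by apply: cvg_at_right_filter; apply: cF; rewrite lexx ler01.
  - by apply: cvg_at_left_filter; apply: cF; rewrite lexx ler01.
have {dFoo} := FTC dFoo.
have dE : {in `]0, 1[, (fun s : R => g (line p q s) 0 i)^`()%classic =1
    (fun r : R => \sum_j h j r)}.
  move=> r; rewrite in_itv /= => /andP[r0 r1].
  have r01 : 0 <= r <= 1 by rewrite !ltW.
  by have [_ +] := dF r r01; rewrite derive1E.
move=> /(_ dE) {dE}FTC.
have {FTC} -> : g p 0 i - g q 0 i =
    \int[@lebesgue_measure R]_(x in `[0, 1]) (\sum_j h j x).
  by rewrite /Rintegral FTC.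
rewrite Rintegral_sum // mxE; apply: eq_bigr => j _.
by rewrite !mxE -RintegralZr // /h; apply: eq_Rintegral => r _; rewrite !mxE.
Qed.

Lemma Rintegral_cst01 (R : realType) (c : R) :
  \int[@lebesgue_measure R]_(r in `[0, 1]) c = c.
Proof.
have mu1 : (@lebesgue_measure R) `[0, 1]%classic = 1%:E.
  by rewrite lebesgue_measure_itv /= lte_fin ltr01 oppr0 adde0.
rewrite /Rintegral integral_cst //.
transitivity (fine (c%:E * 1%:E)%E); last by rewrite mule1.
by congr (fine (_ * _)%E); exact: mu1.
Qed.

Lemma mean_jacobian_norm_le (R : realType) (n : nat)
    (f : R -> 'rV[R]_n -> 'rV[R]_n) (p q : R -> 'rV[R]_n) (t M : R) :
  mean_jacobian_defined f p q t ->
  (forall r, 0 <= r <= 1 -> `|Jac (f t) (line (p t) (q t) r)| <= M) ->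
  `|mean_jacobian f p q t| <= M.
Proof.
move=> mj JM.
have M0 : 0 <= M by apply: le_trans (JM 0 _); rewrite ?lexx ?ler01.
apply: norm_le_entries => // i j; rewrite mxE.
rewrite (le_trans (le_normr_Rintegral _ _)) //; first exact: mj.
rewrite -[leRHS]Rintegral_cst01.
apply: le_Rintegral => //.
- exact: integrable_norm (mj i j).
- apply: continuous_compact_integrable; first exact: segment_compact.
  by apply/withinP => r _; exact: cvg_cst.
- by move=> r; rewrite /= in_itv /= => r01; rewrite (le_trans _ (JM r r01)) // entry_le_norm.
Qed.

(** * A uniform essential bound on the Jacobian *)

(* Without a uniform bound, the complements of the sets that carry unbounded
   values of [G] generate a proper filter; [tx] is a cluster point of it. *)
Lemma compact_near_not_negligible (R : realType) (V : normedModType R)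
    (Omega : set V) (G : R -> V -> R) (b : R) : compact Omega ->
  (forall M, ~ \forall t \ae (@lebesgue_measure R), t \in `[0, b] ->
     forall x, Omega x -> G t x <= M) ->
  exists2 tx : R * V, 0 <= tx.1 /\ Omega tx.2 & forall (e r N : R), 0 < e -> 0 < r ->
    ~ (@lebesgue_measure R).-negligible [set t | [/\ t \in `[0, b],
        `|t - tx.1| < e & exists x, [/\ Omega x, `|x - tx.2| < r & N < G t x]]].
Proof.
move=> cO nb.
pose bad (N : R) (S : set (R * V)) := [set t | t \in `[0, b] /\
  exists x, [/\ Omega x, S (t, x) & N < G t x]].
(* [S] is in [F] when, for almost every [t], all values of [G t] above some level [N] are taken at
   points of [S]. *)
pose F (S : set (R * V)) := exists N, (@lebesgue_measure R).-negligible (bad N (~` S)).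
have FF : ProperFilter F.
  split.
    move=> [N NF]; apply: (nb N); apply: negligibleS NF => t /= /not_implyP[tb].
    move=> /existsNP[x /not_implyP[Ox /negP GN]]; split => //.
    by exists x; split => //; rewrite ltNge.
  split.
  - exists 0; apply: negligibleS (negligible_set0 _) => t /= [_ [x [_]]].
    by rewrite setCT.
  - move=> A B [N1 N1P] [N2 N2P]; exists (Num.max N1 N2).
    apply: negligibleS (negligibleU N1P N2P) => t /= [tb [x [Ox + NG]]].
    move: NG; rewrite gt_max => /andP[NG1 NG2].
    by rewrite setCI => -[h|h]; [left|right]; split => //; exists x.
  - move=> A B AB [N NP]; exists N; apply: negligibleS NP => t /= [tb [x [Ox h NG]]].
    by split => //; exists x; split => // /AB.
have FK : F (`[0, b]%classic `*` Omega).
  exists 0; apply: negligibleS (negligible_set0 _) => t /= [tb [x [Ox h _]]].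
  by apply: h; split.
have [[t x] [[/= tb Ox] clF]] := compact_setX (@segment_compact R 0 b) cO FF FK.
exists (t, x) => /=; first by split => //; move: tb; rewrite in_itv /= => /andP[].
move=> e r N e0 r0 neg.
pose B := ball t e `*` ball x r.
have nB : nbhs (t, x) B.
  exists (ball t e, ball x r) => //=; split; exact: nbhsx_ballx.
have FB : F (~` B).
  exists N; apply: negligibleS neg => s /= [sb [y [Oy + NG]]].
  rewrite setCK => -[/= ts xy]; split => //.
    by rewrite distrC.
  by exists y; split => //; rewrite distrC; move: xy; rewrite -ball_normE.
by have [y [nBy By]] := clF _ _ FB nB.
Qed.

(** For [0 < c] and [d' < d], a continuous cut-off supported in the annulus between the radii [d']
    and [d]; its plateau of value 1 exhausts the open annulus as [c] grows. *)
Definition annulus_bump (R : realType) (t0 d d' c t : R) : R :=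
  Num.min 1 (Num.max 0 (c * (`|t - t0| - d') * (d - `|t - t0|))).

Lemma annulus_bump_itv (R : realType) (t0 d d' c t : R) :
  0 <= annulus_bump t0 d d' c t <= 1.
Proof. by rewrite /annulus_bump le_min ler01 le_max lexx /= ge_min lexx. Qed.

Lemma annulus_bump_neq0 (R : realType) (t0 d d' c t : R) : d' <= d -> 0 <= c ->
  annulus_bump t0 d d' c t != 0 -> d' < `|t - t0| < d.
Proof.
move=> dd c0; apply: contraNT => h.
have : c * (`|t - t0| - d') * (d - `|t - t0|) <= 0.
  move: h; rewrite negb_and -!leNgt -mulrA => /orP[h|h].
    rewrite mulr_ge0_le0 // mulr_le0_ge0 ?subr_le0 // subr_ge0.
    exact: le_trans dd.
  rewrite mulr_ge0_le0 // mulr_ge0_le0 ?subr_le0 // subr_ge0.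
  exact: le_trans dd _.
move=> /max_idPl; rewrite /annulus_bump => ->.
by apply/eqP/min_idPr.
Qed.

Lemma annulus_bump_continuous (R : realType) (t0 d d' c : R) :
  continuous (annulus_bump t0 d d' c).
Proof.
move=> t; rewrite /annulus_bump.
have cn : `|s - t0| @[s --> t] --> `|t - t0|.
  by apply: cvg_norm; apply: cvgB; [exact: cvg_id|exact: cvg_cst].
suff cm : c * (`|s - t0| - d') * (d - `|s - t0|) @[s --> t] -->
    c * (`|t - t0| - d') * (d - `|t - t0|).
  exact: (@continuous_min R R (cst 1) _ t (cvg_cst _)
    (@continuous_max R R (cst 0) _ t (cvg_cst _) cm)).
apply: cvgM; last by apply: cvgB => //; exact: cvg_cst.
apply: cvgM; first exact: cvg_cst.
by apply: cvgB => //; exact: cvg_cst.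
Qed.

Lemma nat_gt (R : realType) (x : R) : exists k : nat, x < k%:R.
Proof.
exists (Num.truncn `|x|).+1; rewrite (le_lt_trans (ler_norm _)) //.
exact: truncnS_gt.
Qed.

Lemma harmonic_lt (R : realType) (e : R) : 0 < e -> exists k : nat, k.+1%:R^-1 < e.
Proof.
move=> e0; have [k ke] := nat_gt e^-1; exists k.
rewrite invf_plt ?posrE // (lt_le_trans ke) // ler_nat //.
Qed.

(** In the hypothesis the point [x] varies with [t]. By continuity of [G t] it can be taken in the
    dense sequence [u]; apart from [t0], the set is then a countable union over inner radii, slopes
    [c] and indices [k], and some member is not negligible. *)
Lemma not_negligible_annulus (R : realType) (V : normedModType R)
    (Omega : set V) (G : R -> V -> R) (b : R) (u : nat -> V) (t0 : R) (x0 : V)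
    (d r N : R) :
  (forall k, Omega (u k)) ->
  (forall x e, Omega x -> 0 < e -> exists k, `|u k - x| < e) ->
  (forall t, 0 <= t -> {within Omega, continuous (G t)}) ->
  0 < d ->
  ~ (@lebesgue_measure R).-negligible [set t | [/\ t \in `[0, b],
        `|t - t0| < d & exists x, [/\ Omega x, `|x - x0| < r & N < G t x]]] ->
  exists d' (c : nat) x, [/\ 0 < d' < d, Omega x, `|x - x0| < r &
   ~ (@lebesgue_measure R).-negligible [set t | [/\ t \in `[0, b],
        N < G t x & 1 <= c%:R * (`|t - t0| - d') * (d - `|t - t0|)]]].
Proof.
move=> Ou du cG d0; apply: contra_notP => h.
(* With [m.+2] the inner radius is strictly below [d] already for [m = 0]. *)
pose E (m c k : nat) := [set t | [/\ t \in `[0, b],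
   `|u k - x0| < r, N < G t (u k) &
   1 <= c%:R * (`|t - t0| - d / m.+2%:R) * (d - `|t - t0|)]].
have nE m c k : (@lebesgue_measure R).-negligible (E m c k).
  have [kr|kr] := ltP `|u k - x0| r; last first.
    by apply: negligibleS (negligible_set0 _) => t [_]; rewrite ltNge kr.
  apply: contrapT => nn; apply: h; exists (d / m.+2%:R), c, (u k); split => //.
    by rewrite divr_gt0 //= ltr_pdivrMr // ltr_pMr // ltr1n.
  by apply: contra_not nn; apply: negligibleS => t [? ? ? ?]; split.
have nt0 : (@lebesgue_measure R).-negligible [set t0].
  apply/negligibleP; first exact: measurable_set1.
  exact: lebesgue_measure_set1.
have nU : (@lebesgue_measure R).-negligible
    (\bigcup_m \bigcup_c \bigcup_k E m c k).
  by do 3 (apply: negligible_bigcup => ?).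
apply: negligibleS (negligibleU nt0 nU) => t [tb td [x [Ox xr NG]]].
have [->|tt0] := eqVneq t t0; [by left|right].
have tb' := tb; move: tb'; rewrite in_itv /= => /andP[t_ge0 _].
have s0 : 0 < `|t - t0| by rewrite normr_gt0 subr_eq0.
have [m mP] : exists m : nat, d / m.+2%:R < `|t - t0|.
  have [m mP] := harmonic_lt (divr_gt0 s0 d0); exists m.
  rewrite mulrC -ltr_pdivlMr // (le_lt_trans _ mP) //.
  by rewrite lef_pV2 ?posrE // ler_nat.
have [k [kx kN]] : exists k, `|u k - x0| < r /\ N < G t (u k).
  have /withinP/(_ x Ox)/cvgrPdist_lt/(_ (G t x - N)) := cG t t_ge0.
  rewrite subr_gt0 => /(_ NG) /nbhs_ballP[e /= e0 eP].
  have er0 : 0 < Num.min e (r - `|x - x0|) by rewrite lt_min e0 subr_gt0.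
  have [k] := du x _ Ox er0; rewrite lt_min => /andP[ke kr]; exists k; split.
    by have := ler_distD x (u k) x0; move=> *; lra.
  have := eP (u k); rewrite -ball_normE /= distrC => /(_ ke (Ou k)).
  by have := ler_norm (G t x - G t (u k)) => *; lra.
have pos : 0 < (`|t - t0| - d / m.+2%:R) * (d - `|t - t0|).
  by rewrite mulr_gt0 // subr_gt0.
have [c cP] := nat_gt ((`|t - t0| - d / m.+2%:R) * (d - `|t - t0|))^-1.
exists m => //; exists c => //; exists k => //; split => //.
by rewrite -mulrA -ler_pdivrMr // mul1r ltW.
Qed.

Lemma dist_lt_split3 (R : realType) (V : normedModType R) (p q a b : V) (e : R) :
  `|p - a| < e / 3 -> `|q - b| < e / 3 -> `|a - b| < e / 3 -> `|p - q| < e.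
Proof.
move=> pa qb ab.
have := ler_distD a p q; have := ler_distD b a q; rewrite (distrC b q) => *.
lra.
Qed.

(* If there were no bound, the path [p] would pass through the point [x k] while
   [G t (x k) > k] on a non-negligible set of times [t] in the [k]-th annulus
   around [t0]; since [x k --> x0], this path is continuous. *)
Lemma uniform_ess_bound (R : realType) (V : normedModType R)
    (Omega : set V) (G : R -> V -> R) (u : nat -> V) :
  compact Omega ->
  (forall p q r, Omega p -> Omega q -> 0 <= r <= 1 ->
     Omega (r *: p + (1 - r) *: q)) ->
  (forall k, Omega (u k)) ->
  (forall x e, Omega x -> 0 < e -> exists k, `|u k - x| < e) ->
  (forall t, 0 <= t -> {within Omega, continuous (G t)}) ->
  (forall p : R -> V, continuous p -> (forall t, Omega (p t)) ->
     forall b, exists M, \forall t \ae (@lebesgue_measure R),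
       t \in `[0, b] -> G t (p t) <= M) ->
  forall b, exists M, \forall t \ae (@lebesgue_measure R),
    t \in `[0, b] -> forall x, Omega x -> G t x <= M.
Proof.
move=> cO convO Ou du cG Gp b; apply: contrapT => /forallNP nb.
have [[t0 x0] [/= t00 Ox0] neg] := compact_near_not_negligible cO nb.
have /choice[step stepP] : forall dk : R * nat, exists y : R * nat * V,
    0 < dk.1 -> [/\ 0 < y.1.1 < dk.1, Omega y.2, `|y.2 - x0| < dk.2.+1%:R^-1 &
   ~ (@lebesgue_measure R).-negligible [set t | [/\ t \in `[0, b],
        dk.2%:R < G t y.2 & 1 <= y.1.2%:R * (`|t - t0| - y.1.1) * (dk.1 - `|t - t0|)]]].
  move=> [d k] /=; have [d0|] := pselect (0 < d); last by exists (0, 0%N, x0).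
  have r0 : 0 < k.+1%:R^-1 :> R by rewrite invr_gt0.
  have [d' [c [x h]]] := not_negligible_annulus Ou du cG d0 (neg d _ k%:R d0 r0).
  by exists (d', c, x).
(* The inner radius of each annulus is the outer radius of the next, which makes the annuli
   disjoint. *)
pose fix dl (k : nat) : R := if k is k'.+1 then (step (dl k', k')).1.1 else 1.
have dl0 k : 0 < dl k.
  by elim: k => [|k IHk] /=; [exact: ltr01|have [/andP[]] := stepP (dl k, k) IHk].
have dlS k : dl k.+1 < dl k by have [/andP[]] := stepP (dl k, k) (dl0 k).
have dl_le j k : (j <= k)%N -> dl k <= dl j.
  elim: k => [|k IHk]; first by rewrite leqn0 => /eqP->.
  rewrite leq_eqVlt => /orP[/eqP->//|]; rewrite ltnS => /IHk.
  by apply: le_trans; exact/ltW/dlS.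
pose x k := (step (dl k, k)).2.
pose c k := (step (dl k, k)).1.2.
have Ox k : Omega (x k) by have [] := stepP (dl k, k) (dl0 k).
have xk k : `|x k - x0| < k.+1%:R^-1 by have [] := stepP (dl k, k) (dl0 k).
pose phi k t := annulus_bump t0 (dl k) (dl k.+1) (c k)%:R t.
have phi_itv k t : 0 <= phi k t <= 1 by exact: annulus_bump_itv.
have phi_neq0 k t : phi k t != 0 -> dl k.+1 < `|t - t0| < dl k.
  by apply: annulus_bump_neq0 => //; exact/ltW/dlS.
have phi_disj j k t : phi j t != 0 -> phi k t != 0 -> j = k.
  move=> /phi_neq0/andP[h1 h2] /phi_neq0/andP[h3 h4].
  have [jk|kj|//] := ltngtP j k.
    by have := lt_trans h1 (lt_le_trans h4 (dl_le _ _ jk)); rewrite ltxx.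
  by have := lt_trans h3 (lt_le_trans h2 (dl_le _ _ kj)); rewrite ltxx.
pose psi k t := phi k t *: (x k - x0).
(* At most one bump is nonzero at [t], so [p t] lies on the segment from [x0] to a single [x k]. *)
pose p t := x0 + if pselect (exists k, phi k t != 0) is left h
                 then psi (sval (cid h)) t else 0.
have pE k t : phi k t != 0 -> p t = x0 + psi k t.
  move=> kt; rewrite /p; case: pselect => [h|[]]; last by exists k.
  by rewrite (phi_disj _ _ _ (svalP (cid h)) kt).
have p0 t : (forall k, phi k t = 0) -> p t = x0.
  move=> h; rewrite /p; case: pselect => [h'|]; last by rewrite addr0.
  by have := svalP (cid h'); rewrite h eqxx.
have Op t : Omega (p t).
  have [[k kt]|h] := pselect (exists k, phi k t != 0).
    rewrite (pE k) // /psi scalerBr addrCA -{1}[x0]scale1r -scalerBl.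
    exact: convO.
  by rewrite p0 // => k; apply/eqP/negPn/negP => kt; apply: h; exists k.
(* An excursion of index [k >= K] has size at most [|x k - x0|], so the continuous partial sums
   converge uniformly to [p]. *)
have pS K t : `|p t - (x0 + \sum_(k < K) psi k t)| <= K.+1%:R^-1.
  have [[k kt]|h] := pselect (exists k, phi k t != 0).
    have psi0 j : j != k -> psi j t = 0.
      move=> jk; rewrite /psi; have [->|jt] := eqVneq (phi j t) 0.
        by rewrite scale0r.
      by rewrite (phi_disj _ _ _ jt kt) eqxx in jk.
    rewrite (pE k) //; have [kK|Kk] := ltnP k K.
      rewrite (bigD1 (Ordinal kK)) //= big1 ?addr0 ?subrr ?normr0 //.
      by move=> j jk; exact: psi0.
    rewrite big1 => [|j _]; last by apply: psi0; rewrite ltn_eqF // (leq_trans (ltn_ord j)).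
    rewrite addr0 addrC addKr /psi normrZ ger0_norm; last by case/andP: (phi_itv k t).
    have /andP[_ p1] := phi_itv k t.
    rewrite (@le_trans _ _ `|x k - x0|) ?ler_piMl // (le_trans (ltW (xk k))) //.
    by rewrite lef_pV2 ?posrE // ler_nat.
  have phi0 k : phi k t = 0 by apply/eqP/negPn/negP => kt; apply: h; exists k.
  rewrite p0 // big1 ?addr0 ?subrr ?normr0 // => k _.
  by rewrite /psi phi0 scale0r.
have cp : continuous p.
  move=> t; apply/cvgrPdist_lt => e e0.
  have [K Ke] := harmonic_lt (divr_gt0 e0 (ltr0n R 3)).
  have cS : (x0 + \sum_(k < K) psi k s) @[s --> t] --> x0 + \sum_(k < K) psi k t.
    have cpsi (k : 'I_K) : psi k s @[s --> t] --> psi k t.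
      exact: (cvgZr_tmp (@annulus_bump_continuous R t0 (dl k) (dl k.+1) (c k)%:R t)).
    have cSum := @cvg_sum_seq _ _ _ _ _ (index_enum 'I_K) _ _ _ cpsi.
    exact: (cvgD (cvg_cst _) (cSum _)).
  have e30 : 0 < e / 3 by rewrite divr_gt0.
  move/cvgrPdist_lt : cS => /(_ _ e30); apply: filterS => s.
  by move=> h; apply: dist_lt_split3 h; rewrite (le_lt_trans (pS K _)).
have [M MP] := Gp p cp Op b.
have [k Mk] := nat_gt M.
(* On the plateau of the [k]-th bump [p t = x k], where [G t] exceeds [k > M]; these times are not
   negligible. *)
have [_ _ _] := stepP (dl k, k) (dl0 k); apply.
apply: negligibleS MP => t /= [tb Gk ck].
apply/not_implyP; split => //; apply/negP; rewrite -ltNge (lt_trans Mk) //.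
have phi1 : phi k t = 1.
  rewrite /phi /annulus_bump; apply/min_idPl.
  by rewrite le_max; apply/orP; right.
by rewrite (pE k) /psi phi1 ?scale1r ?oner_eq0 // addrC subrK.
Qed.

Lemma rat_approx (R : realType) (x e : R) : 0 < e ->
  exists q : rat, `|x - ratr q| < e.
Proof.
move=> e0; have [|q] := @rat_in_itvoo R (x - e) (x + e).
  by rewrite ltrD2l gtrN.
rewrite in_itv /= => /andP[q1 q2]; exists q.
by rewrite ltr_norml; apply/andP; split; lra.
Qed.

(** Rational points may lie outside [Omega], so each pair of a rational point and a radius selects a
    point of [Omega] in that ball, or [x0] if there is none. *)
Lemma rowspace_separable (R : realType) (n : nat) (Omega : set 'rV[R]_n) x0 :
  Omega x0 -> exists u : nat -> 'rV[R]_n, (forall k, Omega (u k)) /\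
  forall x e, Omega x -> 0 < e -> exists k, `|u k - x| < e.
Proof.
move=> Ox0.
have /choice[w wP] : forall qm : 'rV[rat]_n * nat, exists y, Omega y /\
    ((exists2 y, Omega y & `|y - map_mx ratr qm.1| < qm.2.+1%:R^-1) ->
     `|y - map_mx ratr qm.1| < qm.2.+1%:R^-1).
  move=> [q m] /=.
  have [[y Oy h]|h] := pselect (exists2 y, Omega y & `|y - map_mx ratr q| < m.+1%:R^-1).
    by exists y.
  by exists x0; split => // /h.
exists (fun k => oapp w x0 (unpickle k)); split.
  by move=> k; case: unpickle => //= qm; have [] := wP qm.
move=> x e Ox e0.
have [m me] := harmonic_lt (divr_gt0 e0 (ltr0n R 2)).
have [h [h0 he hE]] : exists h : R, [/\ 0 < h, h < e / 2 & h = m.+1%:R^-1].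
  by exists m.+1%:R^-1; rewrite invr_gt0.
have /choice[q qP] : forall j : 'I_n, exists q : rat, `|x 0 j - ratr q| < h / 2.
  by move=> j; apply: rat_approx; rewrite divr_gt0.
pose Q : 'rV[rat]_n := \row_j q j.
have xQ : `|x - map_mx ratr Q| < h.
  apply: (@le_lt_trans _ _ (h / 2)); last lra.
  apply: norm_le_entries => [|i j]; first lra.
  by rewrite !mxE [i]ord1 ltW.
have [_ /=] := wP (Q, m); rewrite -hE => wQ.
exists (pickle (Q, m)); rewrite pickleK /=.
apply: (le_lt_trans (ler_distD (map_mx ratr Q) _ _)); rewrite [e]splitr ltrD //.
  exact: lt_trans (wQ (ex_intro2 _ _ x Ox xQ)) he.
by rewrite distrC (lt_trans xQ).
Qed.

(** * Convergence of stroboscopic orbits *)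

(** [P] singles out a subsequence: all indices, or those at which the orbit stays away from a given
    point. *)
Lemma compact_seq_cluster (R : realType) (V : normedModType R) (Omega : set V)
    (o : nat -> V) (P : nat -> Prop) : compact Omega -> (forall j, Omega (o j)) ->
  (forall K, exists2 j, (K <= j)%N & P j) ->
  exists2 w, Omega w & forall e K, 0 < e ->
    exists j, [/\ (K <= j)%N, P j & `|o j - w| < e].
Proof.
move=> cO Oo infP.
pose F (S : set V) := exists K, forall j, (K <= j)%N -> P j -> S (o j).
have FF : ProperFilter F.
  split; first by move=> [K KP]; have [j Kj Pj] := infP K; exact: (KP j Kj Pj).
  split; first by exists 0%N.
  - move=> A B [K1 h1] [K2 h2]; exists (maxn K1 K2) => j.
    by rewrite geq_max => /andP[j1 j2] Pj; split; [exact: h1|exact: h2].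
  - by move=> A B AB [K h]; exists K => j Kj Pj; exact/AB/h.
have FO : F Omega by exists 0%N => j _ _; exact: Oo.
have [w [Ow cw]] := cO F FF FO; exists w => // e K e0.
have FK : F [set y | exists2 j, (K <= j)%N /\ P j & y = o j].
  by exists K => j Kj Pj; exists j.
have [y [[j [Kj Pj] ->] jw]] := cw _ _ FK (nbhsx_ballx w e e0).
by exists j; split => //; rewrite distrC; move: jw; rewrite -ball_normE.
Qed.

Lemma eventually_nondecreasing_cvg (R : realType) (a : nat -> R) (K : nat) (B : R) :
  (forall k, `|a k| <= B) -> (forall k, (K <= k)%N -> a k <= a k.+1) ->
  exists l, forall e, 0 < e -> exists N, forall k, (N <= k)%N -> `|a k - l| < e.
Proof.
move=> aB amono; pose b k := a (k + K)%N.
have bmono : {homo b : m k / (m <= k)%N >-> m <= k}.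
  by apply/nondecreasing_seqP => k; exact: (amono _ (leq_addl _ _)).
have ubb : has_ubound (range b).
  by exists B => _ [k _ <-]; exact: le_trans (ler_norm _) (aB _).
have /cvg_ex[l cl] := nondecreasing_is_cvgn bmono ubb.
exists l => e e0; move/cvgrPdist_lt : cl => /(_ e e0) [N _ NP].
exists (N + K)%N => k Nk.
have Nk' : (N <= k - K)%N by lia.
have := NP (k - K)%N Nk'; rewrite /b /= distrC subnK //.
by rewrite (leq_trans _ Nk) // leq_addl.
Qed.

Lemma eventually_monotone_cvg (R : realType) (a : nat -> R) (K : nat) (B : R) :
  (forall k, `|a k| <= B) ->
  (forall k, (K <= k)%N -> a k <= a k.+1) \/
  (forall k, (K <= k)%N -> a k.+1 <= a k) ->
  exists l, forall e, 0 < e -> exists N, forall k, (N <= k)%N -> `|a k - l| < e.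
Proof.
move=> aB [amono|amono]; first exact: eventually_nondecreasing_cvg amono.
have [||l lP] := @eventually_nondecreasing_cvg R (fun k => - a k) K B.
- by move=> k; rewrite normrN.
- by move=> k Kk; rewrite lerN2 amono.
exists (- l) => e e0; have [N NP] := lP e e0; exists N => k Nk.
by rewrite opprK -normrN opprD; exact: NP.
Qed.

Lemma nonvanishing_sign (R : realType) (g : R -> R) (t0 : R) : 0 <= t0 ->
  {within `[0, +oo[, continuous g} -> (forall t, t0 < t -> g t != 0) ->
  (forall t, t0 < t -> 0 < g t) \/ (forall t, t0 < t -> g t < 0).
Proof.
move=> t00 cg g0.
have key a b : t0 < a -> a <= b -> (0 < g a) = (0 < g b).
  move=> ta ab; have tb := lt_le_trans ta ab.
  have cab : {within `[a, b], continuous g}.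
    apply: continuous_subspaceW cg => x /=; rewrite !in_itv /= andbT => /andP[ax _].
    exact: le_trans t00 (le_trans (ltW ta) ax).
  apply/idP/idP => h; apply: contraT; rewrite -leNgt => h'.
    have [|c] := IVT (v := 0) ab cab.
      by rewrite ge_min h' orbT le_max (ltW h).
    rewrite in_itv /= => /andP[ac _] gc.
    by have := g0 c (lt_le_trans ta ac); rewrite gc eqxx.
  have [|c] := IVT (v := 0) ab cab.
    by rewrite ge_min h' /= le_max (ltW h) orbT.
  rewrite in_itv /= => /andP[ac _] gc.
  by have := g0 c (lt_le_trans ta ac); rewrite gc eqxx.
have key' a b : t0 < a -> t0 < b -> (0 < g a) = (0 < g b).
  move=> ta tb; have [ab|/ltW ba] := leP a b; first exact: key.
  by apply/esym; exact: key.
have t1 : t0 < t0 + 1 by rewrite ltrDl.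
have [h|h] := ltP 0 (g (t0 + 1)).
  by left => t tt; rewrite -(key' _ _ t1 tt).
right => t tt; rewrite lt_neqAle g0 //= leNgt -(key' _ _ t1 tt) -leNgt //.
Qed.

(* Smillie's argument: the observable [pi] is eventually strictly monotone along
   the stroboscopic orbit [x (k T)], so it is constant on the limit set of that
   orbit, which by the dichotomy must then be a single fixed point. *)
Lemma smillie_convergence (R : realType) (V : normedModType R) (Omega : set V)
    (Sol : (R -> V) -> Prop) (pi : V -> R) (T C : R) :
  compact Omega -> 0 < T ->
  (forall u v, `|pi u - pi v| <= `|u - v|) ->
  (forall x, Sol x -> forall t, 0 <= t -> Omega (x t)) ->
  (forall p, Omega p -> exists2 x, Sol x & x 0 = p) ->
  (forall x, Sol x -> {within `[0, +oo[, continuous (fun t => pi (x t))}) ->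
  (forall x, Sol x -> Sol (fun t => x (t + T))) ->
  (forall x y, Sol x -> Sol y -> forall t, 0 <= t <= T ->
     `|x t - y t| <= C * `|x 0 - y 0|) ->
  (forall x y, Sol x -> Sol y -> (forall t, 0 <= t -> x t = y t) \/
     exists t0, forall t, t0 < t -> pi (x t) != pi (y t)) ->
  forall x, Sol x -> exists eta, [/\ Sol eta,
    forall t, 0 <= t -> eta (t + T) = eta t &
    (`|x t - eta t| @[t --> +oo%R] --> (0 : R))%classic].
Proof.
move=> cO T0 piL sO sE sC sS sL sD x Sx.
have [xT|[t1 t1P]] := sD _ _ (sS _ Sx) Sx.
  exists x; split => //.
  have -> : (fun t => `|x t - x t|) = cst 0 by apply/funext => t; rewrite subrr normr0.
  exact: cvg_cst.
have kT0 k : 0 <= k%:R * T by rewrite mulr_ge0 // ltW.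
have shiftk y k : Sol y -> Sol (fun t => y (t + k%:R * T)).
  move=> Sy; elim: k => [|k IHk].
    rewrite (_ : (fun t => _) = y) //; apply/funext => t.
    by rewrite mul0r addr0.
  rewrite (_ : (fun t => _) = fun t => (fun s => y (s + k%:R * T)) (t + T)).
    exact: (sS _ IHk).
  by apply/funext => t; rewrite -natr1 mulrDl mul1r (addrC _ T) addrA.
have orbit_lip y z k : Sol y -> Sol z ->
    `|y (k%:R * T) - z (k%:R * T)| <= `|C| ^+ k * `|y 0 - z 0|.
  move=> Sy Sz; elim: k => [|k IHk]; first by rewrite mul0r expr0 mul1r.
  have := sL _ _ (shiftk y k Sy) (shiftk z k Sz) T.
  rewrite lexx ltW // => /(_ isT); rewrite !add0r.
  rewrite -natr1 mulrDl mul1r (addrC _ T) exprS -mulrA => /le_trans; apply.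
  rewrite (le_trans (ler_wpM2r (normr_ge0 _) (ler_norm C))) //.
  by rewrite ler_wpM2l.
pose o k := x (k%:R * T).
have Oo k : Omega (o k) by exact: sO.
have [B BP] : exists B, forall k, `|pi (o k)| <= B.
  have [B0 [_ /(_ (`|B0| + 1))]] := compact_bounded cO.
  rewrite (le_lt_trans (ler_norm _)) ?ltrDl // => /(_ isT) BO.
  exists (`|pi (o 0%N)| + 2 * (`|B0| + 1)) => k.
  have := piL (o k) (o 0%N); have := BO _ (Oo k); have := BO _ (Oo 0%N).
  rewrite /=.
  have := ler_normB (o k) (o 0%N); have := lerB_dist (pi (o k)) (pi (o 0%N)).
  by move=> *; lra.
have cz : {within `[0, +oo[, continuous (fun t => pi (x (t + T)) - pi (x t))}.
  apply/withinP => t t0; apply: cvgB.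
    by have := sC _ (sS _ Sx) => /withinP; apply.
  by have := sC _ Sx => /withinP; apply.
have [K KP] := nat_gt (Num.max 0 t1 / T).
have Kt k : (K <= k)%N -> Num.max 0 t1 < k%:R * T.
  move=> Kk; rewrite -ltr_pdivrMr // (lt_le_trans KP) // ler_nat //.
have oS k : o k.+1 = x (k%:R * T + T) by rewrite /o -natr1 mulrDl mul1r.
have [al alP] : exists l, forall e, 0 < e ->
    exists N, forall k, (N <= k)%N -> `|pi (o k) - l| < e.
  (* The difference of [pi] along the shifted and the original solution keeps one sign past [t1];
     this sign is the direction of monotonicity. *)
  apply: (@eventually_monotone_cvg _ _ K B) => //.
  have [||h|h] := @nonvanishing_sign R _ (Num.max 0 t1) _ cz.
  - by rewrite le_max lexx.
  - by move=> t; rewrite gt_max => /andP[_ tt]; rewrite subr_eq0 t1P.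
  - left => k /Kt/h; rewrite subr_gt0 => /ltW.
    by rewrite -oS.
  - right => k /Kt/h; rewrite subr_lt0 => /ltW.
    by rewrite -oS.
(* If [y 0] is a limit point of [o j], then [y (k T)] is one of [o (j + k)], by the Lipschitz bound
   over [k] periods. *)
have cluster_pi y k : Sol y ->
    (forall e N, 0 < e -> exists j, [/\ (N <= j)%N, True & `|o j - y 0| < e]) ->
    pi (y (k%:R * T)) = al.
  move=> Sy yc; apply/eqP; rewrite -subr_eq0 -normr_le0; apply/ler_addgt0Pr => e e0; rewrite add0r.
  have [N NP] := alP _ (divr_gt0 e0 (ltr0n R 2)).
  have Ck : 0 < `|C| ^+ k + 1 by rewrite ltr_wpDl // exprn_ge0.
  have [|j [Nj _ jy]] := yc (e / 2 / (`|C| ^+ k + 1)) N.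
    by rewrite divr_gt0 // divr_gt0.
  have h1 := NP (j + k)%N (leq_trans Nj (leq_addr _ _)).
  have h2 := orbit_lip _ _ k (shiftk x j Sx) Sy.
  have h3 := piL (y (k%:R * T)) (o (j + k)%N).
  rewrite /= add0r -mulrDl -natrD (addnC k) distrC in h2.
  have h4 : `|C| ^+ k * `|x (j%:R * T) - y 0| <= e / 2.
    rewrite ltr_pdivlMr // in jy; rewrite (le_trans _ (ltW jy)) // mulrC.
    by rewrite ler_wpM2l // lerDl.
  have := ler_distD (pi (o (j + k)%N)) (pi (y (k%:R * T))) al.
  by rewrite /o in h1 h3 *; lra.
have infT N : exists2 j, (N <= j)%N & True by exists N.
have [w Ow wc] := compact_seq_cluster cO Oo infT.
have [y Sy y0] := sE _ Ow.
have yc e N : 0 < e -> exists j, [/\ (N <= j)%N, True & `|o j - y 0| < e].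
  by rewrite y0; exact: wc.
have big t2 : exists k, t2 < k%:R * T.
  have [k kP] := nat_gt (t2 / T); exists k; rewrite -ltr_pdivrMr //.
have yT t : 0 <= t -> y (t + T) = y t.
  (* Otherwise [pi] would separate the two solutions at all late times, while at multiples of [T] it
     equals [al] on both. *)
  have [h|[t2 t2P]] := sD _ _ (sS _ Sy) Sy; first exact: h.
  have [k kP] := big t2; have := t2P _ kP.
  have -> : k%:R * T + T = k.+1%:R * T by rewrite -natr1 mulrDl mul1r.
  by rewrite !cluster_pi ?eqxx.
have ocv e : 0 < e -> exists N, forall j, (N <= j)%N -> `|o j - y 0| < e.
  move=> e0; apply: contrapT => h.
  (* Infinitely many orbit points at distance at least [e] would accumulate at a second limit point,
     which the dichotomy identifies with [y 0]. *)
  have infe N : exists2 j, (N <= j)%N & e <= `|o j - y 0|.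
    apply: contrapT => h'; apply: h; exists N => j Nj; rewrite ltNge; apply/negP => ej.
    by apply: h'; exists j.
  have [w' Ow' wc'] := compact_seq_cluster cO Oo infe.
  have [y' Sy' y0'] := sE _ Ow'.
  have yc' r N : 0 < r -> exists j, [/\ (N <= j)%N, True & `|o j - y' 0| < r].
    by move=> r0; have [j [Nj _ jw]] := wc' r N r0; exists j; rewrite y0'.
  have yy : y 0 = y' 0.
    have [/(_ 0 (lexx _))//|[t2 t2P]] := sD _ _ Sy Sy'.
    have [k kP] := big t2; have := t2P _ kP.
    by rewrite !cluster_pi ?eqxx.
  have [j [_ ej]] := wc' e 0%N e0.
  by rewrite -y0' -yy ltNge ej.
exists y; split => //.
have yk k t : 0 <= t -> y (t + k%:R * T) = y t.
  move=> t0; elim: k => [|k IHk]; first by rewrite mul0r addr0.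
  by rewrite -natr1 mulrDl mul1r addrA yT // addr_ge0.
apply/cvgrPdist_lt => e e0.
have C0 : 0 < `|C| + 1 by rewrite ltr_wpDl.
have [N NP] := ocv _ (divr_gt0 e0 C0).
near=> t.
have Nt : N%:R * T <= t by near: t; apply: nbhs_pinfty_ge; exact: num_real.
have t0 : 0 <= t by exact: le_trans (kT0 N) Nt.
(* Write [t = s + j T] with [s] in one period and compare there the solution started at [o j] with
   [y]. *)
pose j := Num.truncn (t / T).
have /andP[jt tj] : j%:R <= t / T < j.+1%:R by apply: truncn_itv; rewrite divr_ge0 // ltW.
have Nj : (N <= j)%N.
  rewrite -ltnS -(ltr_nat R) (le_lt_trans _ tj) // ler_pdivlMr //.
rewrite ler_pdivlMr // in jt; rewrite ltr_pdivrMr // in tj.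
rewrite -natr1 mulrDl mul1r in tj.
pose s := t - j%:R * T.
have s0 : 0 <= s <= T by apply/andP; split; rewrite /s; lra.
have st : t = s + j%:R * T by rewrite /s subrK.
rewrite sub0r normrN normr_id [t in y t]st yk; last by case/andP: s0.
rewrite [t in x t]st.
have := sL _ _ (shiftk x j Sx) Sy s s0; rewrite add0r => /le_lt_trans; apply.
have := NP j Nj; rewrite ltr_pdivlMr // mulrC; apply: le_lt_trans.
by rewrite ler_wpM2r // (le_trans (ler_norm C)) // lerDl.
Unshelve. all: by end_near. Qed.

(** * Differences of solutions *)

Lemma locally_abs_continuous_within (R : realType) (V : normedModType R)
    (F : R -> V) : locally_abs_continuous `[0, +oo[ F ->
  {within `[0, +oo[, continuous F}.
Proof.
move=> acF; apply/withinP => x /=; rewrite in_itv /= andbT => x0.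
have /abs_continuous_within/withinP/(_ x) : abs_continuous 0 (x + 1) F.
  by apply: acF => y /=; rewrite !in_itv /= andbT => /andP[].
rewrite /= in_itv /= x0 lerDl ler01 => /(_ isT) cx P /cx NP.
have {}NP : nbhs x [set y | `[0, x + 1]%classic y -> P (F y)] := NP.
change (nbhs x [set y | `[0, +oo[%classic y -> P (F y)]).
have h : nbhs x ([set y | `[0, x + 1]%classic y -> P (F y)] `&` ball x 1).
  by apply: filterI => //; exact: nbhsx_ballx.
apply: filterS h => y [/= yP].
rewrite -ball_normE /= ltr_norml => /andP[y1 _]; rewrite in_itv /= andbT => y0.
by apply: yP; rewrite in_itv /= y0 /=; lra.
Qed.

Definition solution_in (R : realType) (n : nat) (f : R -> 'rV[R]_n -> 'rV[R]_n)
    (Omega : set 'rV[R]_n) (x : R -> 'rV[R]_n) : Prop :=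
  is_solution f 0 x /\ forall t, 0 <= t -> Omega (x t).

(** Degenerate lines turn the hypothesis on mean Jacobians into a bound on the Jacobian itself along
    any continuous path in [Omega]. *)
Lemma mean_jacobian_diag (R : realType) (n : nat)
    (f : R -> 'rV[R]_n -> 'rV[R]_n) (p : R -> 'rV[R]_n) (t : R) :
  mean_jacobian f p p t = Jac (f t) (p t).
Proof.
apply/matrixP => i j; rewrite mxE -[RHS]Rintegral_cst01.
by apply: eq_Rintegral => r _; rewrite line_same.
Qed.

Lemma solution_in_endpoints (R : realType) (n : nat)
    (f : R -> 'rV[R]_n -> 'rV[R]_n) (Omega : set 'rV[R]_n) u v :
  solution_in f Omega u -> solution_in f Omega v -> line_endpoints Omega u v.
Proof.
move=> [[acu _] Ou] [[acv _] Ov].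
split; first exact: locally_abs_continuous_within acu.
  exact: locally_abs_continuous_within acv.
by move=> t t0; split; [exact: Ou|exact: Ov].
Qed.

Lemma abs_continuous_solution_diff (R : realType) (n : nat)
    (f : R -> 'rV[R]_n -> 'rV[R]_n) (Omega : set 'rV[R]_n) u v a b :
  solution_in f Omega u -> solution_in f Omega v -> 0 <= a ->
  abs_continuous a b (fun t => (u t - v t)^T).
Proof.
move=> [[acu _] _] [[acv _] _] a0.
apply: (@abs_continuous_linear _ _ _ (@trmx R 1 n)); first exact: norm_trmx_le.
have ab : `[a, b] `<=` (`[0, +oo[%classic : set R).
  by move=> x /=; rewrite !in_itv /= andbT => /andP[/(le_trans a0)].
by apply: abs_continuousB; [exact: acu|exact: acv].
Qed.

Lemma is_derive_solution_diff (R : realType) (n : nat)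
    (f : R -> 'rV[R]_n -> 'rV[R]_n) (Omega : set 'rV[R]_n) u v :
  convex_set Omega -> (forall t, 0 <= t -> C1_on Omega (f t)) ->
  solution_in f Omega u -> solution_in f Omega v ->
  \forall t \ae (@lebesgue_measure R), 0 <= t ->
    is_derive (t : R^o) 1 ((fun s => (u s - v s)^T) : R^o -> 'cV[R]_n)
      (mean_jacobian f u v t *m (u t - v t)^T).
Proof.
move=> cO fC1 [[_ du] Ou] [[_ dv] Ov].
apply: ae_impl (ae_and du dv) => t [Du Dv] t0.
rewrite -(mean_value_line cO (fC1 t t0) (Ou t t0) (Ov t t0)).
apply: (is_derive_linear (@norm_trmx_le R 1 n)).
have := is_deriveB (Du t0) (Dv t0); exact.
Qed.

Lemma abs_continuous_shift (R : realType) (V : normedModType R) (a b T : R)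
    (F : R -> V) : abs_continuous (a + T) (b + T) F ->
  abs_continuous a b (fun t => F (t + T)).
Proof.
move=> acF e e0; have [d d0 dP] := acF e e0; exists d => // m u v uab uv uvd.
apply: (dP m (fun i => u i + T) (fun i => v i + T)).
- by move=> i; have [? [? ?]] := uab i; rewrite !lerD2r.
- by move=> i j /uv; rewrite !lerD2r.
- by move: uvd; under [X in _ -> X < _]eq_bigr => i _ do rewrite opprD addrACA subrr addr0.
Qed.

Lemma solution_in_shift (R : realType) (n : nat)
    (f : R -> 'rV[R]_n -> 'rV[R]_n) (Omega : set 'rV[R]_n) (T : R) x : 0 <= T ->
  (forall t z, 0 <= t -> Omega z -> f t z = f (t + T) z) ->
  solution_in f Omega x -> solution_in f Omega (fun t => x (t + T)).
Proof.
move=> T0 fT [[acx dx] Ox]; split; last first.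
  by move=> t t0; apply: Ox; rewrite addr_ge0.
split.
  (* For [b < a] the inclusion [ab] is vacuous and tells nothing about [a], but then only the empty
     family is admissible. *)
  move=> a b ab; apply: abs_continuous_shift; have [ba|ab'] := ltP b a.
    move=> e e0; exists 1 => // m u v uab _ _.
    rewrite big1 // => i _; have [? [? ?]] := uab i; lra.
  apply: acx => t /=; rewrite !in_itv /= andbT => /andP[aT tb].
  have := ab a; rewrite /= !in_itv /= lexx ab' => /(_ isT); rewrite andbT => a0.
  by rewrite (le_trans _ aT) // addr_ge0.
apply: ae_impl (ae_shift T dx) => t Dx t0.
have tT : 0 <= t + T by rewrite addr_ge0.
rewrite (fT _ _ t0 (Ox _ tT)).
exact: is_derive_shift (Dx tT).
Qed.

Lemma solution_in_invariant (R : realType) (n : nat)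
    (f : R -> 'rV[R]_n -> 'rV[R]_n) (Omega : set 'rV[R]_n) x :
  invariant_domain f Omega -> is_solution f 0 x -> Omega (x 0) ->
  solution_in f Omega x.
Proof.
move=> inv sx Ox; split => // t t0.
have [y [_ _ yO yu]] := inv 0 (x 0) (lexx _) Ox.
by rewrite (yu x sx erefl t t0); exact: yO.
Qed.

(** Both sides solve the same linear equation and agree at [s]; the growth bound applied to their
    difference gives uniqueness. *)
Lemma transition_solution_diff (R : realType) (n : nat)
    (f : R -> 'rV[R]_n -> 'rV[R]_n) (Omega : set 'rV[R]_n)
    (Phi : R -> R -> 'M[R]_n) u v s t :
  convex_set Omega -> (forall t, 0 <= t -> C1_on Omega (f t)) ->
  solution_in f Omega u -> solution_in f Omega v ->
  locally_ess_bounded `[0, +oo[ (mean_jacobian f u v) ->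
  is_transition `]0, +oo[ (mean_jacobian f u v) Phi -> 0 < s -> s <= t ->
  (u t - v t)^T = Phi t s *m (u s - v s)^T.
Proof.
move=> cO fC1 Su Sv bA trP s0 st.
have Is : `]0, +oo[%classic s by rewrite /= in_itv /= s0.
have [Pss acP dP] := trP s Is.
pose c := (u s - v s)^T.
pose d r := Phi r s *m c - (u r - v r)^T.
suff dt : `|d t| = 0.
  by move/eqP: dt; rewrite normr_eq0 subr_eq0 => /eqP.
have [|M MP] := bA s t.
  move=> r /=; rewrite !in_itv /= andbT => /andP[sr _].
  exact: le_trans (ltW s0) sr.
have [C CP] := linear_ode_bound n (t - s) M.
have mulL x : `|mulmxr c x| <= (n%:R * `|c|) * `|x| :> R.
  by rewrite /= (le_trans (norm_mulmx_le _ _)) // mulrAC.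
have := CP s t (mean_jacobian f u v) d st (lexx _).
have -> : d s = 0 by rewrite /d Pss mul1mx subrr.
rewrite normr0 mulr0 => dle; apply/eqP; rewrite eq_le normr_ge0 andbT.
apply: dle.
- apply: abs_continuousB; last exact: abs_continuous_solution_diff Su Sv (ltW s0).
  apply: (@abs_continuous_linear _ _ _ (mulmxr c)); first exact: mulL.
  by apply: acP => r /=; rewrite !in_itv /= andbT => /andP[sr _]; exact: lt_le_trans sr.
- apply: ae_impl (ae_and dP (is_derive_solution_diff cO fC1 Su Sv)) => r [DP Dz].
  rewrite in_itv /= => /andP[sr _].
  have r0 : 0 < r by exact: lt_le_trans sr.
  rewrite /d mulmxBr mulmxA.
  apply: is_deriveB; last exact: Dz (ltW r0).
  have Ir : `]0, +oo[%classic r by rewrite /= in_itv /= r0.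
  have DL := is_derive_linear (@mulL n : forall x, _) (DP Ir).
  exact: DL.
- exact: MP.
Qed.

Lemma solution_diff_dichotomy (R : realType) (n : nat)
    (f : R -> 'rV[R]_n.+1 -> 'rV[R]_n.+1) (Omega : set 'rV[R]_n.+1) u v :
  convex_set Omega -> (forall t, 0 <= t -> C1_on Omega (f t)) ->
  solution_in f Omega u -> solution_in f Omega v ->
  locally_ess_bounded `[0, +oo[ (mean_jacobian f u v) ->
  TPDS `]0, +oo[ (mean_jacobian f u v) ->
  (forall t, 0 <= t -> u t = v t) \/
  exists t0, forall t, t0 < t -> u t 0 0 != v t 0 0.
Proof.
move=> cO fC1 Su Sv bA [Phi trP TP].
pose z t := (u t - v t)^T.
have zE s t : 0 < s -> s <= t -> z t = Phi t s *m z s.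
  move=> s0 st; exact: (transition_solution_diff cO fC1 Su Sv bA trP s0 st).
have {}TP s t : 0 < s -> s < t -> totally_positive (Phi t s).
  by move=> s0 st; apply: TP => //=; rewrite in_itv /= andbT // (lt_trans s0).
have z0uv t : z t = 0 -> u t = v t.
  by move=> zt; apply/eqP; rewrite -subr_eq0 -[u t - v t]trmxK -/(z t) zt trmx0.
have [[s s0 zs]|znz] := pselect (exists2 s, 0 < s & z s = 0).
  have zpos t : 0 < t -> z t = 0.
    move=> t0; have [st|ts] := leP s t; first by rewrite (zE s) // zs mulmx0.
    (* The full determinant is itself a minor, so [Phi s t] is invertible and a zero at [s]
       propagates backwards. *)
    have Pinv : Phi s t \in unitmx.
      rewrite unitmxE unitfE gt_eqF //.
      by have := TP t s t0 ts n.+1 id id; rewrite mxsub_id; apply.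
    have := zE t s t0 (ltW ts); rewrite zs => /(congr1 (mulmx (invmx (Phi s t)))).
    by rewrite mulKmx // mulmx0.
  left => t; rewrite le_eqVlt => /orP[/eqP <-|t0]; last exact/z0uv/zpos.
  (* At time 0 absolute continuity carries the value 0 back from a positive time shorter than
     [d]. *)
  apply/z0uv/eqP; rewrite -normr_le0; apply/ler_addgt0Pr => e e0; rewrite add0r.
  have acz := @abs_continuous_solution_diff _ _ _ _ _ _ 0 1 Su Sv (lexx _).
  have [d d0 dP] := abs_continuous_seq acz e0.
  have r0 : 0 < Num.min 1 (d / 2) by rewrite lt_min ltr01 divr_gt0.
  have := dP [:: (0, Num.min 1 (d / 2))].
  rewrite !big_cons !big_nil /= !addr0 subr0 -/(z _) -/(z 0) zpos // sub0r normrN.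
  move=> /(_ _ isT) h; apply/ltW/h.
    by rewrite lexx (ltW r0) ge_min lexx.
  by rewrite gt_min; apply/orP; right; rewrite ltr_pdivrMr // ltr_pMr // ltr1n.
right.
have {}znz t : 0 < t -> z t != 0.
  by move=> t0; apply/eqP => zt; apply: znz; exists t.
(* [Q m] pairs a strict count at some time with the bound it imposes on weak counts afterwards; the
   least such [m] gives [t0]. *)
pose Q m := exists2 t, 0 < t & strictly_alternating m (z t) /\
  forall t', t < t' -> ~ weakly_alternating m.+1 (z t').
have Qt t : 0 < t -> exists2 m, strictly_alternating m (z t) &
    forall t', t < t' -> ~ weakly_alternating m.+1 (z t').
  move=> t0; have [m [sm wm]] := variation_diminishing (znz t t0).
  exists m => // t' tt'; rewrite (zE t t' t0 (ltW tt')); apply: wm; exact: TP.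
have exQ : exists m, `[< Q m >].
  have [m sm wm] := Qt 1 ltr01; exists m; apply/asboolP; exists 1 => //.
case: (ex_minnP exQ) => m /asboolP[t0 t00 [_ wm]] mmin.
exists t0 => t tt0; apply/negP => /eqP uv0.
have t_gt0 := lt_trans t00 tt0.
have [m' sm' wm'] := Qt t t_gt0.
have mm' : (m <= m')%N by apply: mmin; apply/asboolP; exists t.
(* At a zero of the first entry after [t0], the strict count [m' >= m] becomes a weak count [m'.+1],
   against the bound set at [t0]. *)
apply: (wm t tt0); apply: (@weakly_alternating_le _ _ m'.+1) => //.
apply: alternating_cons sm'.
by rewrite /z !mxE uv0 subrr.
Qed.

(** One essential bound on the Jacobian over all of [Omega] passes to every mean Jacobian, so the
    same growth constant serves all pairs of solutions. *)
Lemma solution_lipschitz (R : realType) (n : nat)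
    (f : R -> 'rV[R]_n -> 'rV[R]_n) (Omega : set 'rV[R]_n) (T : R) :
  compact Omega -> convex_set Omega -> (forall t, 0 <= t -> C1_on Omega (f t)) ->
  (forall p q : R -> 'rV[R]_n, line_endpoints Omega p q ->
     (forall t, 0 <= t -> mean_jacobian_defined f p q t) /\
     locally_ess_bounded `[0, +oo[ (mean_jacobian f p q)) ->
  exists C, forall u v, solution_in f Omega u -> solution_in f Omega v ->
    forall t, 0 <= t <= T -> `|u t - v t| <= C * `|u 0 - v 0|.
Proof.
move=> cO cvO fC1 mj.
have [[x0 Ox0]|noO] := pselect (exists x0, Omega x0); last first.
  by exists 0 => u v [_ Ou]; exfalso; apply: noO; exists (u 0); apply: Ou.
have [w [Ow dw]] := rowspace_separable Ox0.
have [||p cp Op b|M MP] := @uniform_ess_bound R _ Omega (fun t x => `|Jac (f t) x|) w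
    cO _ Ow dw _ _ T.
- by move=> p q r Op Oq r01; exact: line_convex.
- move=> t t0; have [_ cJ] := fC1 t t0; apply/withinP => x Ox.
  by apply: cvg_norm; move: cJ => /withinP; apply.
- have [|_ /(_ 0 b)[|M MP]] := mj p p.
  + split => //; exact: continuous_subspaceT.
  + by move=> t /=; rewrite !in_itv /= andbT => /andP[].
  + by exists M; apply: ae_impl MP => t; rewrite mean_jacobian_diag.
have [C CP] := linear_ode_bound n T M.
exists C => u v Su Sv t /andP[t0 tT].
have [mjd _] := mj u v (solution_in_endpoints Su Sv).
have [_ Ou] := Su; have [_ Ov] := Sv.
have normT (z : 'rV[R]_n) : `|z^T| = `|z|.
  apply/eqP; rewrite eq_le; have := norm_trmx_le z; rewrite mul1r => -> /=.
  by have := norm_trmx_le z^T; rewrite mul1r trmxK.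
rewrite -normT -[`|u 0 - v 0|]normT.
apply: (CP 0 t (mean_jacobian f u v) (fun t => (u t - v t)^T)) => //.
- by rewrite subr0.
- exact: abs_continuous_solution_diff Su Sv (lexx _).
- apply: ae_impl (is_derive_solution_diff cvO fC1 Su Sv) => s + /=.
  by rewrite in_itv /= => + /andP[s0 _]; apply.
- apply: ae_impl MP => s sM; rewrite in_itv /= => /andP[s0 st].
  apply: mean_jacobian_norm_le; first exact: mjd.
  move=> r r01; apply: sM; first by rewrite in_itv /= s0 (le_trans st).
  by apply: line_convex => //; [exact: Ou|exact: Ov].
Qed.

Theorem theorem10 (R : realType) (n : nat) (Omega : set 'rV[R]_n)
    (f : R -> 'rV[R]_n -> 'rV[R]_n) (T : R)
    (Omega_compact : compact Omega)
    (Omega_convex : convex_set Omega)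
    (f_C1 : forall t, 0 <= t -> C1_on Omega (f t))
    (Omega_invariant : invariant_domain f Omega)
    (T_gt0 : 0 < T)
    (f_TPDS : forall p q : R -> 'rV[R]_n, line_endpoints Omega p q ->
      [/\ forall t, 0 <= t -> mean_jacobian_defined f p q t,
          locally_ess_bounded `[0, +oo[ (mean_jacobian f p q),
          measurable_mx `[0, +oo[ (mean_jacobian f p q) &
          TPDS `]0, +oo[ (mean_jacobian f p q)])
    (f_periodic : forall t z, 0 <= t -> Omega z -> f t z = f (t + T) z) :
  forall x : R -> 'rV[R]_n, is_solution f 0 x -> Omega (x 0) ->
    exists eta : R -> 'rV[R]_n,
      [/\ is_solution f 0 eta,
          forall t, 0 <= t -> eta (t + T) = eta t &
          (`|x t - eta t| @[t --> +oo%R] --> (0 : R))%classic].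
Proof.
move=> x sx Ox.
have [C CP] : exists C, forall u v, solution_in f Omega u -> solution_in f Omega v ->
    forall t, 0 <= t <= T -> `|u t - v t| <= C * `|u 0 - v 0|.
  by apply: solution_lipschitz => // p q /f_TPDS[].
(* The observable is the first coordinate, so dimension 0, where all states coincide, is treated
   apart. *)
case: n Omega f Omega_compact Omega_convex f_C1 Omega_invariant f_TPDS f_periodic
    x sx Ox C CP => [|n] Omega f cO cvO fC1 inv f_TPDS f_per x sx Ox C CP.
  exists x; split => //; first by move=> t _; rewrite [LHS]thinmx0 [RHS]thinmx0.
  have -> : (fun t => `|x t - x t|) = cst 0 by apply/funext => t; rewrite subrr normr0.
  exact: cvg_cst.
have Sx := solution_in_invariant inv sx Ox.
have [|||||||eta [[seta _] etaT etax]] := @smillie_convergence R _ Omega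
    (solution_in f Omega) (fun z => z 0 0) T C cO T_gt0 _ _ _ _ _ _ _ x Sx.
- by move=> u v; have := entry_le_norm (u - v) 0 0; rewrite !mxE.
- by move=> y [].
- move=> p Op; have [y [sy y0 yO _]] := inv 0 p (lexx _) Op.
  by exists y.
- move=> y [[acy _] _]; apply/withinP => t t0.
  have /withinP/(_ t t0) cy := locally_abs_continuous_within acy.
  exact: (cvg_comp _ _ cy (@coord_continuous _ _ _ 0 0 _)).
- by move=> y; apply: solution_in_shift => //; exact: ltW.
- exact: CP.
- move=> u v Su Sv.
  have [_ bA _ tp] := f_TPDS _ _ (solution_in_endpoints Su Sv).
  exact: solution_diff_dichotomy Su Sv bA tp.
- by exists eta.
Qed.
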